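(* Let $f,g\colon(\mathbb{C}^n,0)\to(\mathbb{C},0)$ be reduced complex analytic function germs and let $\mathcal{T}\subset\mathcal{H}$ be an invariant set of $\mathcal{S}$. Suppose that any element of $\mathcal{T}$ preserves weakly relative multiplicities. If there exists $\varphi\in\mathcal{T}$ such that $f=g\circ\varphi$, then $m(V(f),0)=m(V(g),0)$.
   Context: $V(f)$ denotes the zero set (germ) of $f$. For a reduced holomorphic germ $f\colon(\mathbb{C}^n,0)\to(\mathbb{C},0)$ (in particular not identically zero, without repeated irreducible factors), write $f=f_m+f_{m+1}+\cdots$ with $f_k$ homogeneous of degree $k$ and $f_m\neq 0$. The multiplicity of $V(f)$ at $0$ is $m(V(f),0):=m$, and the tangent cone of $V(f)$ at $0$ is $C(V(f),0)=V(f_m)\subset\mathbb{C}^n$. Decompose $f_m=h_1^{k_1}\cdots h_r^{k_r}$ into powers of pairwise non-associate irreducible polynomials; the irreducible components of $C(V(f),0)$ are the $V(h_i)$, and the relative multiplicity of $V(f)$ along $V(h_i)$ is $k_{V(f)}(V(h_i)):=k_i$. For each $n\in\mathbb{N}$ (positive integers), $\mathcal{H}_n$ is the collection of all germs of homeomorphisms from $(\mathbb{C}^n,0)$ to $(\mathbb{C}^n,0)$, and $\mathcal{H}=\bigcup_{n\in\mathbb{N}}\mathcal{H}_n$. The map $\mathcal{S}\colon\mathcal{H}\to\mathcal{H}$ is $\mathcal{S}(\varphi)=\varphi\times\mathrm{id}_{\mathbb{C}}$. A subset $\mathcal{T}\subset\mathcal{H}$ is an invariant set of $\mathcal{S}$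 if $\mathcal{S}(\mathcal{T})\subset\mathcal{T}$. A homeomorphism $\varphi\colon(\mathbb{C}^n,0)\to(\mathbb{C}^n,0)$ preserves weakly relative multiplicities if for any two reduced complex analytic function germs $f,g\colon(\mathbb{C}^n,0)\to(\mathbb{C},0)$ such that $f=g\circ\varphi$ and at least one of $C(V(f),0)$, $C(V(g),0)$ is a linear subspace, both $C(V(f),0)$ and $C(V(g),0)$ are irreducible and $k_{V(f)}(C(V(f),0))=k_{V(g)}(C(V(g),0))$. *)

(* Defs.v *)
From HB Require Import structures.
From mathcomp Require Import all_boot all_order all_algebra.
From mathcomp Require Import complex mpoly.
From mathcomp Require Import boolp classical_sets reals topology normedtype.

Set Implicit Arguments.
Unset Strict Implicit.
Unset Printing Implicit Defensive.

Import Order.TTheory GRing.Theory Num.Theory numFieldNormedType.Exports.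

Local Open Scope classical_set_scope.
Local Open Scope quotient_scope.
Local Open Scope ring_scope.

(* R[i] itself carries no canonical topology; going through its numClosedFieldType
   structure gives C, and then C^n = 'rV[C]_n, the topology of numFieldNormedType. *)
Definition Cplx (R : realType) : numClosedFieldType := R[i].

(* Germs at 0 of scalar functions are handled through
   representatives defined on all of C^n (with junk values away from 0); every
   notion below depends only on the restriction to a neighbourhood of 0. *)

Section AnalyticGerms.
Variables (R : realType) (n : nat).
Local Notation C := (Cplx R).
Local Notation Cn := 'rV[C]_n.
Implicit Types (f g h a b q : Cn -> C) (c : 'X_{1..n} -> C).

Definition monomial_at (x : Cn) (m : 'X_{1..n}) : C :=
  \prod_(i < n) x ord0 i ^+ m i.

(* Absolute convergence is stated as boundedness of the partial sums, taken over
   the multi-indices of total degree < N. *)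
Definition power_series_at0 f c :=
  \forall x \near (0 : Cn),
    (exists M : C, forall N : nat,
       \sum_(m : 'X_{1..n < N}) `|c m * monomial_at x m| <= M) /\
    ((fun N : nat => \sum_(m : 'X_{1..n < N}) c m * monomial_at x m : C)
       @ \oo --> (f x : C)).

Definition analytic_germ f := exists c, power_series_at0 f c.

Definition unit_germ a :=
  analytic_germ a /\
  exists b, analytic_germ b /\ \forall x \near (0 : Cn), a x * b x = 1.

Definition irreducible_germ h :=
  [/\ analytic_germ h,
      ~ (\forall x \near (0 : Cn), h x = 0),
      ~ unit_germ h
    & forall a b, analytic_germ a -> analytic_germ b ->
        (\forall x \near (0 : Cn), h x = a x * b x) ->
        unit_germ a \/ unit_germ b].

Definition reduced_germ f :=
  [/\ analytic_germ f, f 0 = 0,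
      ~ (\forall x \near (0 : Cn), f x = 0)
    & forall h q, irreducible_germ h -> analytic_germ q ->
        ~ (\forall x \near (0 : Cn), f x = h x ^+ 2 * q x)].

(* The coefficients are unique, so the choice made by xget is immaterial. *)
Definition taylor_coef f : 'X_{1..n} -> C :=
  xget (fun=> 0) [set c | power_series_at0 f c].

Definition homogeneous_part f (k : nat) : {mpoly C[n]} :=
  \sum_(m : 'X_{1..n < k.+1} | mdeg m == k) taylor_coef f m *: 'X_[m].

Definition multiplicity f : nat :=
  xget 0%N [set m | homogeneous_part f m != 0 /\
                    forall k, (k < m)%N -> homogeneous_part f k = 0].

Definition initial_form f : {mpoly C[n]} :=
  homogeneous_part f (multiplicity f).

Definition zero_locus (p : {mpoly C[n]}) : set Cn :=
  [set x | p.@[x ord0] = 0].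

Definition tangent_cone f : set Cn := zero_locus (initial_form f).

Definition linear_subspace (A : set Cn) :=
  exists W : {vspace Cn}, A = [set x | x \in W].

Definition algebraic_set (A : set Cn) :=
  exists I : set {mpoly C[n]}, A = \bigcap_(p in I) zero_locus p.

Definition irreducible_set (A : set Cn) :=
  A !=set0 /\
  forall A1 A2, algebraic_set A1 -> algebraic_set A2 ->
    A = A1 `|` A2 -> A = A1 \/ A = A2.

Definition irreducible_mpoly (p : {mpoly C[n]}) :=
  [/\ p != 0, p \isn't a GRing.unit
    & forall a b : {mpoly C[n]}, p = a * b ->
        a \is a GRing.unit \/ b \is a GRing.unit].

Definition associate_mpoly (p q : {mpoly C[n]}) :=
  exists2 u : {mpoly C[n]}, u \is a GRing.unit & q = u * p.

(* No unit factor is needed for a nonconstant p: C is algebraically closed, so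
   a scalar can be absorbed into one of the h i. *)
Definition factorization (p : {mpoly C[n]}) (r : nat)
    (h : 'I_r -> {mpoly C[n]}) (k : 'I_r -> nat) :=
  [/\ forall i, irreducible_mpoly (h i),
      forall i, (0 < k i)%N,
      forall i j, i != j -> ~ associate_mpoly (h i) (h j)
    & p = \prod_(i < r) h i ^+ k i].

(* Meaningful when X is an irreducible component of the tangent cone of f; the
   value is 0 otherwise. *)
Definition relative_multiplicity f (X : set Cn) : nat :=
  xget 0%N [set d | exists r (h : 'I_r -> {mpoly C[n]}) (k : 'I_r -> nat) i,
    [/\ factorization (initial_form f) h k, X = zero_locus (h i) & d = k i]].

End AnalyticGerms.

Section HomeoGerms.
Variable R : realType.
Local Notation C := (Cplx R).

Definition local_homeo0 n (phi : 'rV[C]_n -> 'rV[C]_n) :=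
  phi 0 = 0 /\
  exists (U V : set 'rV[C]_n) (psi : 'rV[C]_n -> 'rV[C]_n),
    [/\ open U /\ U 0, open V /\ V 0,
        {in U, continuous phi} /\ {in V, continuous psi},
        forall x, U x -> V (phi x) /\ psi (phi x) = x
      & forall y, V y -> U (psi y) /\ phi (psi y) = y].

Record homeo_map n := HomeoMap {
  homeo_fun :> 'rV[C]_n -> 'rV[C]_n;
  homeo_funP : local_homeo0 homeo_fun }.

HB.instance Definition _ n := gen_eqMixin (homeo_map n).
HB.instance Definition _ n := gen_choiceMixin (homeo_map n).

Definition same_germ n (phi psi : homeo_map n) : bool :=
  `[< \forall x \near (0 : 'rV[C]_n), phi x = psi x >].

Lemma same_germ_refl n : reflexive (@same_germ n).
Proof. by move=> phi; apply/asboolP; near=> x.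
Unshelve. all: by end_near. Qed.

Lemma same_germ_sym n : ssrbool.symmetric (@same_germ n).
Proof.
by move=> phi psi; apply/asboolP/asboolP; apply: filterS => x ->.
Qed.

Lemma same_germ_trans n : ssrbool.transitive (@same_germ n).
Proof.
move=> psi phi chi /asboolP h1 /asboolP h2; apply/asboolP.
by apply: filterS2 h1 h2 => x -> ->.
Qed.

Canonical same_germ_equiv n :=
  EquivRel (@same_germ n) (@same_germ_refl n) (@same_germ_sym n)
    (@same_germ_trans n).

Definition homeo_germ n := {eq_quot @same_germ n}.

(* C^n.+1 is C^n x C, the last coordinate being the C factor. *)
Definition first_coords n (x : 'rV[C]_n.+1) : 'rV[C]_n :=
  \row_i x ord0 (lift ord_max i).

Definition append_coord n (y : 'rV[C]_n) (t : C) : 'rV[C]_n.+1 :=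
  \row_j (if unlift ord_max j is Some i then y ord0 i else t).

Definition times_id_fun n (phi : 'rV[C]_n -> 'rV[C]_n)
    (x : 'rV[C]_n.+1) : 'rV[C]_n.+1 :=
  append_coord (phi (first_coords x)) (x ord0 ord_max).

Lemma cvg_row T (F : set_system T) n (u : T -> 'rV[C]_n) (a : 'rV[C]_n) :
  Filter F -> (forall j, (fun t => u t ord0 j) @ F --> a ord0 j) ->
  u @ F --> a.
Proof.
move=> FF cvu A [P Pa sPA]; apply: (@filterS _ F _
  (fun t => forall j, P ord0 j (u t ord0 j))) => [t Pt|].
  by apply: sPA => i j; rewrite (ord1 i).
by apply: filter_forall => j; apply: (cvu j); apply: Pa.
Qed.

Lemma coord_cvg n (a : 'rV[C]_n) j :
  (fun x : 'rV[C]_n => x ord0 j) @ a --> a ord0 j.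
Proof.
move=> A Aa; exists (fun i k => if k == j then A else setT).
  by move=> i k; rewrite (ord1 i); case: eqP => [->//|_]; apply: filterT.
by move=> x /(_ ord0 j); rewrite eqxx.
Qed.

Lemma first_coords_continuous n : continuous (@first_coords n).
Proof.
move=> a; apply: (@cvg_row _ (nbhs a)) => j; rewrite mxE.
rewrite (_ : (fun t => _) = (fun x : 'rV[C]_n.+1 => x ord0 (lift ord_max j))).
  exact: coord_cvg.
by apply/funext => x; rewrite mxE.
Qed.

Lemma times_id_fun_continuous n (phi : 'rV[C]_n -> 'rV[C]_n) x :
  {for first_coords x, continuous phi} ->
  {for x, continuous (times_id_fun phi)}.
Proof.
move=> cphi; apply: (@cvg_row _ (nbhs x)) => j; rewrite mxE.
case E: (unlift ord_max j) => [i|].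
  rewrite (_ : (fun t => _) = fun t => phi (first_coords t) ord0 i); last first.
    by apply/funext => t; rewrite mxE E.
  apply: (@cvg_comp _ _ _ (phi \o @first_coords n) (fun y : 'rV[C]_n => y ord0 i)
    _ (nbhs (phi (first_coords x)))); last exact: coord_cvg.
  apply: (@cvg_comp _ _ _ (@first_coords n) phi _ (nbhs (first_coords x))).
    exact: first_coords_continuous.
  exact: cphi.
rewrite (_ : (fun t => _) = fun t : 'rV[C]_n.+1 => t ord0 ord_max).
  exact: coord_cvg.
by apply/funext => t; rewrite mxE E.
Qed.

Lemma first_times_id n (phi : 'rV[C]_n -> 'rV[C]_n) x :
  first_coords (times_id_fun phi x) = phi (first_coords x).
Proof. by apply/rowP => j; rewrite !mxE liftK. Qed.

Lemma times_id_funK n (phi psi : 'rV[C]_n -> 'rV[C]_n) x :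
  psi (phi (first_coords x)) = first_coords x ->
  times_id_fun psi (times_id_fun phi x) = x.
Proof.
move=> psiK; apply/rowP => j; rewrite mxE first_times_id psiK.
case: unliftP => [i ->|->]; first by rewrite mxE.
by rewrite mxE unlift_none.
Qed.

Lemma first_coords0 n : first_coords 0 = 0 :> 'rV[C]_n.
Proof. by apply/rowP => j; rewrite !mxE. Qed.

Lemma times_id_local_homeo0 n (phi : homeo_map n) :
  local_homeo0 (times_id_fun phi).
Proof.
case: phi => phi [phi0 [U [V [psi [[oU U0] [oV V0] [cphi cpsi] phiK psiK]]]]] /=.
split.
  apply/rowP => j; rewrite !mxE first_coords0 phi0.
  by case: unlift => [i|]; rewrite ?mxE.
exists (@first_coords n @^-1` U), (@first_coords n @^-1` V), (times_id_fun psi).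
have fc A : open A -> open (@first_coords n @^-1` A).
  by apply: open_comp => x _; exact: first_coords_continuous.
split.
- by split; [exact: fc | rewrite /= first_coords0].
- by split; [exact: fc | rewrite /= first_coords0].
- split=> x; rewrite inE => ?; apply: times_id_fun_continuous.
    by apply: cphi; rewrite inE.
  by apply: cpsi; rewrite inE.
- move=> x /= /phiK[Vx xK]; rewrite first_times_id; split=> //.
  exact: times_id_funK.
- move=> y /= /psiK[Uy yK]; rewrite first_times_id; split=> //.
  exact: times_id_funK.
Qed.

Definition times_id n (phi : homeo_map n) : homeo_map n.+1 :=
  HomeoMap (times_id_local_homeo0 phi).

Definition times_id_germ n (phi : homeo_germ n) : homeo_germ n.+1 :=
  \pi_(homeo_germ n.+1) (times_id (repr phi)).

Lemma times_id_germ_pi n (phi : homeo_map n) :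
  times_id_germ (\pi_(homeo_germ n) phi) =
  \pi_(homeo_germ n.+1) (times_id phi).
Proof.
apply/eqquotP/asboolP; set psi := repr _.
have : \forall y \near (0 : 'rV[C]_n), psi y = phi y.
  by apply/asboolP; apply/(@eqquotP _ _ (homeo_germ n)); rewrite reprK.
rewrite -{1}first_coords0 => /(@first_coords_continuous _ (0 : 'rV[C]_n.+1)).
apply: (@filterS _ (nbhs (0 : 'rV[C]_n.+1))) => x e.
by rewrite /= /times_id_fun e.
Qed.

(* The collection of all homeomorphism germs (C^d, 0) -> (C^d, 0), d >= 1; the
   tag of an element is d - 1. *)
Definition homeo_germs : Type := {n : nat & homeo_germ n.+1}.

Definition stabilization (phi : homeo_germs) : homeo_germs :=
  existT (fun n => homeo_germ n.+1) (projT1 phi).+1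
    (times_id_germ (projT2 phi)).

Definition invariant_set (T : set homeo_germs) := stabilization @` T `<=` T.

Definition comp_germ n (f g : 'rV[C]_n -> C) (phi : homeo_germ n) :=
  \forall x \near (0 : 'rV[C]_n), f x = g (repr phi x).

Definition weakly_preserves_relative_multiplicities n (phi : homeo_germ n) :=
  forall f g : 'rV[C]_n -> C, reduced_germ f -> reduced_germ g ->
    comp_germ f g phi ->
    linear_subspace (tangent_cone f) \/ linear_subspace (tangent_cone g) ->
    [/\ irreducible_set (tangent_cone f), irreducible_set (tangent_cone g)
      & relative_multiplicity f (tangent_cone f) =
        relative_multiplicity g (tangent_cone g)].

End HomeoGerms.

(* Main.v *)
(* Suppose m = m(f) < m(g) and put b = 2m + 1.  Suspending once, the germs
   t^b - f^2 and t^b - g^2 are again related by phi x id.  The initial form of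
   the second is t^b, so its tangent cone is the hyperplane t = 0, with relative
   multiplicity b; the initial form of the first has degree at most 2m < b, so
   none of its relative multiplicities can reach b.

   The germ t^b - f^2 is reduced: if it equals h^2 q, then h divides b t^(b-1)
   by differentiation in t.  Comparing lowest monomials, with the t-exponent
   compared first, either h(0) != 0, so that h is a unit, or h vanishes on
   t = 0, which would force f = 0. *)

Require Import Defs.
From mathcomp Require Import all_boot all_order all_algebra.
From mathcomp Require Import complex ssrcomplements mpoly.
From mathcomp Require Import boolp classical_sets reals topology normedtype.
From mathcomp Require Import ring.

Set Implicit Arguments.
Unset Strict Implicit.
Unset Printing Implicit Defensive.

Import Order.TTheory GRing.Theory Num.Theory numFieldNormedType.Exports.

Local Open Scope classical_set_scope.
Local Open Scope ring_scope.

(** The square is what makes room for [b]. With [t^b - f] the argument would need an integer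
    strictly between m(f) and m(g), and there is none when m(g) = m(f) + 1. After squaring, the
    orders 2m(f) and 2m(g) differ by at least two, and 2m(f) + 1 lies strictly between them.

    The two sides of the comparison are treated unequally. A relative multiplicity is computed
    exactly only for a power of a coordinate, where uniqueness of the factorization can be checked
    by hand; on the other side a degree bound that holds for every factorization is enough. General
    unique factorization is thereby avoided.

    Analysis enters mainly at three points: Taylor coefficients are unique, a product of germs has
    the Cauchy product as expansion, and a series with nonzero constant term has an analytic
    inverse. These come from explicit estimates on polydiscs; the algebra then takes place between
    coefficient functions. *)

Lemma digits_inj (B n : nat) (a b : nat -> nat) :
  (forall i, a i < B)%N -> (forall i, b i < B)%N ->
  (\sum_(i < n) a i * B ^ i = \sum_(i < n) b i * B ^ i)%N ->
  forall i, (i < n)%N -> a i = b i.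
Proof.
elim: n a b => [//|n IHn] a b aB bB.
have shift (c : nat -> nat) : (\sum_(i < n.+1) c i * B ^ i =
    (\sum_(i < n) c i.+1 * B ^ i) * B + c 0)%N.
  rewrite big_ord_recl /= expn0 muln1 addnC; congr addn.
  rewrite big_distrl /=; apply: eq_bigr => i _.
  by rewrite /bump /= add1n expnS mulnCA mulnC.
rewrite !shift => eqS; have B0 : (0 < B)%N by apply: leq_ltn_trans (aB 0%N).
have a0 : a 0 = b 0.
  by have := congr1 (modn^~ B) eqS; rewrite /= !modnMDl !modn_small.
move: eqS; rewrite a0 => /addIn/eqP; rewrite eqn_pmul2r // => /eqP eqS [|i] //.
by rewrite ltnS; apply: (IHn (fun i => a i.+1) (fun i => b i.+1)).
Qed.

(* Kronecker's substitution x_i = z^(B^i) keeps distinct monomials distinct. *)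
Lemma mpoly_nonvanishing (K : numFieldType) n (p : {mpoly K[n]}) :
  p != 0 -> exists v : 'I_n -> K, p.@[v] != 0.
Proof.
move=> p0; pose B := msize p.
pose q : {poly K} := mmap polyC (fun i : 'I_n => 'X^(B ^ i)) p.
have entry_lt m i : m \in msupp p -> (m i < B)%N.
  move=> /msize_mdeg_lt; apply: leq_ltn_trans.
  by rewrite mdegE (bigD1 i) //= leq_addr.
pose w (m : 'X_{1..n}) := (\sum_(i < n) m i * B ^ i)%N.
have w_inj : {in msupp p &, injective w}.
  move=> m m' mp m'p eqw; apply/mnmP => i.
  pose ext (k : 'X_{1..n}) j := if insub j is Some i then k i else 0%N.
  have extE (k : 'X_{1..n}) (j : 'I_n) : ext k j = k j.
    by rewrite /ext valK.
  have ext_lt k j : k \in msupp p -> (ext k j < B)%N.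
    move=> kp; rewrite /ext; case: insub => [i'|]; first exact: entry_lt.
    by have := entry_lt _ i kp; apply: leq_ltn_trans.
  rewrite -!extE; apply: (@digits_inj B n); rewrite ?ltn_ord//.
  - by move=> j; apply: ext_lt.
  - by move=> j; apply: ext_lt.
  - by under eq_bigr do rewrite extE; under [RHS]eq_bigr do rewrite extE.
have qE : q = \sum_(m <- msupp p) p@_m *: 'X^(w m).
  rewrite /q /mmap; apply: eq_bigr => m _; rewrite mul_polyC; congr (_ *: _).
  rewrite /mmap1 /w (big_morph _ (exprD 'X) (expr0 'X)).
  by apply: eq_bigr => i _; rewrite -exprM mulnC.
have q0 : q != 0.
  apply/eqP => /(congr1 (fun r : {poly K} => r`_(w (mlead p)))).
  rewrite qE coef_sum coef0 (bigD1_seq (mlead p)) ?mlead_supp ?msupp_uniq //=.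
  rewrite coefZ coefXn eqxx mulr1 big1_seq ?addr0.
    by apply/eqP; rewrite mleadc_eq0.
  move=> m /andP[mp' mp]; rewrite coefZ coefXn; case: eqP => [/esym|_].
    by move=> /(w_inj _ _ mp (mlead_supp p0))/eqP; rewrite (negPf mp').
  by rewrite mulr0.
(* In characteristic zero the integers below [size q] are distinct, and they are more numerous than
   the roots [q] can have. *)
have [a qa] : exists a, ~~ root q a.
  apply: contrapT => noa; pose s := [seq k%:R : K | k <- iota 0 (size q)].
  have : (size s < size q)%N.
    apply: (max_poly_roots q0).
      by apply/allP => a _; apply/negPn/negP => qa; apply: noa; exists a.
    rewrite map_inj_uniq ?iota_uniq // => i j /eqP.
    by rewrite eqr_nat => /eqP.
  by rewrite size_map size_iota ltnn.
exists (fun i => a ^+ (B ^ i)); apply: contra qa => /eqP pa; apply/rootP.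
rewrite -{}pa qE mevalE horner_sum; apply: eq_bigr => m _.
rewrite !hornerE; congr (_ * _).
rewrite /w (big_morph _ (exprD a) (expr0 a)).
by apply: eq_bigr => i _; rewrite -exprM mulnC.
Qed.

Lemma mnm_min n (P : 'X_{1..n} -> Prop) : (exists m, P m) ->
  exists2 u, P u & forall m, P m -> (u <= m)%O.
Proof.
move=> exP; apply: contrapT => nomin; case: exP => m.
elim/(well_founded_ind (@ltom_wf n)): m => m IHm Pm; apply: nomin; exists m => //.
by move=> k Pk; rewrite leNgt; apply/negP => /IHm /(_ Pk).
Qed.

(** * Formal power series as coefficient functions *)

Section FormalSeries.
Variables (K : idomainType) (n : nat).
Implicit Types (c d : 'X_{1..n} -> K) (p q : {mpoly K[n]}).

Definition trunc N c : {mpoly K[n]} := \sum_(m : 'X_{1..n < N}) c m *: 'X_[m].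

(** Cauchy product, indexed as in [mcoeffM] so that on polynomials it matches the product at
    once. *)
Definition conv c d m : K :=
  \sum_(k : 'X_{1..n < (mdeg m).+1, (mdeg m).+1} | m == (k.1 + k.2)%MM)
    c k.1 * d k.2.

(** Congruence modulo degree [N]: identities between series are checked on polynomial truncations,
    where the ring laws are available. *)
Definition approx N p c := forall m, (mdeg m < N)%N -> p@_m = c m.

Lemma mcoeff_trunc N c m : (trunc N c)@_m = if (mdeg m < N)%N then c m else 0.
Proof.
case: ifP => mN; first exact: mcoeff_mpoly.
rewrite /trunc raddf_sum big1 // => k _; rewrite /= mcoeffZ mcoeffX.
case: eqP => [km|_]; last by rewrite mulr0.
by have := bmdeg k; rewrite km mN.
Qed.

Lemma approx_trunc N c : approx N (trunc N c) c.
Proof. by move=> m mN; rewrite mcoeff_trunc mN. Qed.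

Lemma approxW N N' p c : (N' <= N)%N -> approx N p c -> approx N' p c.
Proof. by move=> NN' pc m mN; apply: pc; apply: leq_trans NN'. Qed.

Lemma approxD N p q c d :
  approx N p c -> approx N q d -> approx N (p + q) (fun m => c m + d m).
Proof. by move=> pc qd m mN; rewrite mcoeffD pc ?qd. Qed.

Lemma approxM N p q c d :
  approx N p c -> approx N q d -> approx N (p * q) (conv c d).
Proof.
move=> pc qd m mN; rewrite mcoeffM; apply: eq_bigr => k _.
by rewrite pc ?qd //; apply: leq_trans mN; rewrite bmdeg.
Qed.

Lemma conv_neq0 c d m : conv c d m != 0 ->
  exists k l, [/\ m = (k + l)%MM, c k != 0 & d l != 0].
Proof.
move=> cdm; apply: contrapT => no; case/negP: cdm; apply/eqP.
apply: big1 => k /eqP mE; apply/eqP; rewrite mulf_eq0.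
have [_ //|ck] := eqVneq (c k.1) 0; have [_ //|dk] := eqVneq (d k.2) 0.
by case: no; exists (bmnm k.1), (bmnm k.2).
Qed.

(** Three weights occur: the total degree for multiplicities, the exponent of [t] for reducedness,
    and zero, which leaves the monomial order alone. *)
Definition lowest (wt : 'X_{1..n} -> nat) c u :=
  c u != 0 /\ forall m, c m != 0 ->
    (wt u < wt m)%N \/ wt u = wt m /\ (u <= m)%O.

Lemma lowest_exists wt c : (exists m, c m != 0) -> exists u, lowest wt c u.
Proof.
move=> exc; have exw : exists w, `[< exists2 m, c m != 0 & wt m = w >].
  by case: exc => m cm; exists (wt m); apply/asboolP; exists m.
case: (ex_minnP exw) => w /asboolP[m0 cm0 wm0] wmin.
have [|u [cu wu] umin] := @mnm_min n (fun m => c m != 0 /\ wt m = w).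
  by exists m0.
exists u; split=> // m cm; rewrite wu.
have : (w <= wt m)%N by apply: wmin; apply/asboolP; exists m.
rewrite leq_eqVlt => /predU1P[wm|->]; last by left.
by right; split=> //; apply: umin.
Qed.

(** Weight and monomial order are compatible with addition, so in a decomposition [u + v = k + l]
    within the supports neither [k] nor [l] can lie strictly above its minimum. Only the pair
    [(u, v)] contributes. *)
Lemma lowest_conv wt c d u v : {morph wt : m k / (m + k)%MM >-> (m + k)%N} ->
  lowest wt c u -> lowest wt d v -> conv c d (u + v)%MM = c u * d v.
Proof.
move=> wtD [cu umin] [dv vmin].
have ub : (mdeg u < (mdeg (u + v)%MM).+1)%N by rewrite ltnS mdegD leq_addr.
have vb : (mdeg v < (mdeg (u + v)%MM).+1)%N by rewrite ltnS mdegD leq_addl.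
rewrite /conv (bigD1 (BMultinom ub, BMultinom vb)) //= big1 ?addr0 //.
move=> [k l] /= /andP[/eqP uvE klne]; apply/eqP; rewrite mulf_eq0.
have [_ //|ck] := eqVneq (c k) 0; have [_ //|dl] := eqVneq (d l) 0.
case/negP: klne; have wtE : (wt u + wt v = wt k + wt l)%N by rewrite -!wtD; congr wt.
have {umin} := umin _ ck; have {vmin} := vmin _ dl.
suff fin : (u <= k)%O -> (v <= l)%O -> (k, l) == (BMultinom ub, BMultinom vb).
  case=> [wv|[wv vl]]; case=> [wu|[wu uk]]; last exact: fin.
  - by by have := leq_trans (leq_add (ltnW wu) wv) (leqnn _); rewrite addnS wtE ltnn.
  - by move: wtE wv; rewrite wu => /addnI->; rewrite ltnn.
  - by move: wtE wu; rewrite wv => /addIn->; rewrite ltnn.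
move=> uk vl; have ukE : u = bmnm k.
  apply/le_anti; rewrite uk /= leNgt; apply/negP => ltuk.
  by have := ltmc_le_add ltuk vl; rewrite -uvE ltxx.
have vlE : v = bmnm l by apply: (@addmI _ u); rewrite [X in _ = (X + _)%MM]ukE -uvE.
by rewrite xpair_eqE !bmeqP /= -ukE -vlE !eqxx.
Qed.

Lemma conv_mcoeff p q : conv (fun m => p@_m) (fun m => q@_m) = fun m => (p * q)@_m.
Proof. by apply/funext => m; rewrite mcoeffM. Qed.

End FormalSeries.

(** Smallest and leading monomials both add up under products. In a monomial the two coincide, which
    forces them to coincide in each factor. *)
Lemma mdivisor_monomial (K : idomainType) n (p q : {mpoly K[n]}) a m :
  a != 0 -> p * q = a *: 'X_[m] ->
  exists b u, [/\ b != 0, p = b *: 'X_[u] & exists v, m = (u + v)%MM].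
Proof.
move=> a0 pq; have pq0 : p * q != 0.
  by rewrite pq -msize_poly_eq0 msizeZ // msizeX.
have [p0 q0] : p != 0 /\ q != 0 by apply/andP; rewrite -negb_or -mulf_eq0.
have lowE (r : {mpoly K[n]}) : r != 0 -> exists u, lowest (fun=> 0%N) (fun k => r@_k) u.
  by move=> r0; apply: lowest_exists; exists (mlead r); rewrite mleadc_eq0.
have [[u lowu] [v lowv]] := (lowE p p0, lowE q q0).
have : conv (fun k => p@_k) (fun k => q@_k) (u + v)%MM != 0.
  by rewrite (lowest_conv _ lowu lowv) // mulf_neq0 //; [case: lowu | case: lowv].
rewrite conv_mcoeff pq mcoeffZ mcoeffX; case: (m =P (u + v)%MM) => [muv _|_]; last first.
  by rewrite mulr0 eqxx.
have lem : mlead p = u.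
  have := mleadM p0 q0; rewrite pq mleadZ // mleadXm muv => uvE.
  have uk : (u <= mlead p)%O.
    by case: lowu => _ /(_ (mlead p)); rewrite mleadc_eq0 => /(_ p0)[//|[]].
  have vl : (v <= mlead q)%O.
    by case: lowv => _ /(_ (mlead q)); rewrite mleadc_eq0 => /(_ q0)[//|[]].
  apply/esym/le_anti; rewrite uk /= leNgt; apply/negP => ltuk.
  by have := ltmc_le_add ltuk vl; rewrite uvE ltxx.
exists p@_u, u; split; [by case: lowu| |by exists v].
apply/mpolyP => k; rewrite mcoeffZ mcoeffX; case: eqP => [<-|uk]; rewrite ?mulr1 // mulr0.
apply/eqP; rewrite mcoeff_eq0; apply/negP => kp; apply: uk; apply/le_anti.
rewrite -{2}lem msupp_le_mlead // andbT.
by case: lowu => _ /(_ k); rewrite -mcoeff_msupp => /(_ kp)[//|[]].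
Qed.

(** * Convergent power series *)

Section PolynomialNorm.
Variables (K : numFieldType) (n : nat).
Implicit Types (c d : 'X_{1..n} -> K) (p q : {mpoly K[n]}) (r s : K).

(** Weighted l1 norm of the coefficients. For [r >= 0] it is submultiplicative and dominates the
    values of [p] on the polydisc of radius [r]. *)
Definition pnorm r p : K := \sum_(m <- msupp p) `|p@_m| * r ^+ mdeg m.

Lemma pnormwE N r p : (forall m, p@_m != 0 -> (mdeg m < N)%N) ->
  pnorm r p = \sum_(m : 'X_{1..n < N}) `|p@_m| * r ^+ mdeg m.
Proof.
move=> pN; pose I : subFinType _ := 'X_{1..n < N}.
rewrite /pnorm (big_mksub I) ?msupp_uniq //=; first last.
  by move=> m; rewrite mcoeff_msupp => /pN.
by rewrite big_rmcond //= => m /memN_msupp_eq0 ->; rewrite normr0 mul0r.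
Qed.

Lemma pnorm_bound p : exists N, forall m, p@_m != 0 -> (mdeg m < N)%N.
Proof. by exists (msize p) => m; rewrite -mcoeff_msupp => /msize_mdeg_lt. Qed.

Lemma pnorm_ge0 r p : 0 <= r -> 0 <= pnorm r p.
Proof. by move=> r0; apply: sumr_ge0 => m _; rewrite mulr_ge0 ?exprn_ge0. Qed.

Lemma pnorm_le r p q : 0 <= r -> (forall m, `|p@_m| <= `|q@_m|) ->
  pnorm r p <= pnorm r q.
Proof.
move=> r0 pq; have [N qN] := pnorm_bound q.
rewrite (pnormwE _ qN) (@pnormwE N); last first.
  move=> m pm; apply: qN; apply: contra pm => /eqP qm; move: (pq m).
  by rewrite qm normr0 normr_le0.
by apply: ler_sum => m _; rewrite ler_wpM2r ?exprn_ge0.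
Qed.

Lemma pnormD r p q : 0 <= r -> pnorm r (p + q) <= pnorm r p + pnorm r q.
Proof.
move=> r0; have [[N pN] [M qM]] := (pnorm_bound p, pnorm_bound q).
have bound k (t : {mpoly K[n]}) : (forall m, t@_m != 0 -> (mdeg m < k)%N) ->
    (k <= maxn N M)%N -> forall m, t@_m != 0 -> (mdeg m < maxn N M)%N.
  by move=> tk kNM m /tk /leq_trans; apply.
rewrite (pnormwE _ (bound _ _ pN (leq_maxl _ _))).
rewrite (pnormwE _ (bound _ _ qM (leq_maxr _ _))).
rewrite (@pnormwE (maxn N M)); last first.
  move=> m; rewrite mcoeffD => pqm.
  have [pm|pm] := eqVneq p@_m 0; last exact: (bound _ _ pN (leq_maxl _ _)).
  by apply: (bound _ _ qM (leq_maxr _ _)); rewrite pm add0r in pqm.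
rewrite -big_split; apply: ler_sum => m _.
by rewrite /= -mulrDl ler_wpM2r ?exprn_ge0 // mcoeffD ler_normD.
Qed.

Lemma pnorm0 r : pnorm r 0 = 0.
Proof. by rewrite /pnorm msupp0 big_nil. Qed.

Lemma pnorm_monomial r a m : pnorm r (a *: 'X_[m]) = `|a| * r ^+ mdeg m.
Proof.
have [->|a0] := eqVneq a 0; first by rewrite scale0r pnorm0 normr0 mul0r.
by rewrite /pnorm msuppMCX // big_seq1 mcoeffZ mcoeffX eqxx mulr1.
Qed.

Lemma pnormC r a : pnorm r a%:MP = `|a|.
Proof. by rewrite -alg_mpolyC -mpolyX0 pnorm_monomial mdeg0 mulr1. Qed.

Lemma pnorm_sum r (I : Type) (s : seq I) (F : I -> {mpoly K[n]}) : 0 <= r ->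
  pnorm r (\sum_(i <- s) F i) <= \sum_(i <- s) pnorm r (F i).
Proof.
move=> r0; elim: s => [|i s IHs]; first by rewrite !big_nil pnorm0.
by rewrite !big_cons; apply: le_trans (pnormD _ _ r0) _; rewrite lerD2l.
Qed.

Lemma pnormM r p q : 0 <= r -> pnorm r (p * q) <= pnorm r p * pnorm r q.
Proof.
move=> r0; rewrite [p in pnorm r (p * q)]mpolyE mulr_suml.
apply: le_trans (pnorm_sum _ _ r0) _; rewrite [leRHS]mulr_suml.
apply: ler_sum => m _; rewrite [q in _ * q]mpolyE mulr_sumr.
apply: le_trans (pnorm_sum _ _ r0) _; rewrite [leRHS]mulr_sumr.
apply: ler_sum => k _; rewrite -scalerAl -scalerAr scalerA -mpolyXD.
by rewrite pnorm_monomial mdegD exprD normrM mulrACA.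
Qed.

Lemma pnormX r p k : 0 <= r -> pnorm r (p ^+ k) <= pnorm r p ^+ k.
Proof.
move=> r0; elim: k => [|k IHk]; first by rewrite !expr0 -mpolyC1 pnormC normr1.
rewrite !exprS; apply: le_trans (pnormM _ _ r0) _.
by rewrite ler_wpM2l ?pnorm_ge0.
Qed.

Lemma pnorm_mono r s p : 0 <= s -> s <= r -> pnorm s p <= pnorm r p.
Proof.
move=> s0 sr; apply: ler_sum => m _; rewrite ler_wpM2l //.
by rewrite lerXn2r // nnegrE (le_trans s0).
Qed.

Lemma norm_meval_le s p (x : 'I_n -> K) : (forall i, `|x i| <= s) ->
  `|p.@[x]| <= pnorm s p.
Proof.
move=> xs; rewrite mevalE; apply: le_trans (ler_norm_sum _ _ _) _.
apply: ler_sum => m _; rewrite normrM ler_wpM2l // normr_prod mdegE.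
rewrite (big_morph _ (exprD s) (expr0 s)); apply: ler_prod => i _.
by rewrite normr_ge0 normrX lerXn2r // nnegrE // (le_trans _ (xs i)).
Qed.

(** A term of degree at least [N] shrinks at least by the factor (s/r)^N when the radius drops from
    [r] to [s]; the inequality is cleared of denominators. *)
Lemma pnorm_high r s N p : 0 <= s -> s <= r ->
  (forall m, (mdeg m < N)%N -> p@_m = 0) ->
  pnorm s p * r ^+ N <= pnorm r p * s ^+ N.
Proof.
move=> s0 sr pN; rewrite /pnorm !mulr_suml !big_seq; apply: ler_sum => m.
rewrite mcoeff_msupp => pm.
have Nm : (N <= mdeg m)%N by rewrite leqNgt; apply: contra pm => /pN ->.
have r0 := le_trans s0 sr.
rewrite -!mulrA ler_wpM2l // -(subnK Nm) !exprD -!mulrA.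
rewrite [r ^+ N * _]mulrC ler_wpM2r ?mulr_ge0 ?exprn_ge0 //.
by rewrite lerXn2r // nnegrE.
Qed.

Lemma norm_mcoeff_trunc N c m : `|(trunc N c)@_m| <= `|c m|.
Proof. by rewrite mcoeff_trunc; case: ifP => // _; rewrite normr0. Qed.

Lemma pnorm_trunc N r c :
  pnorm r (trunc N c) = \sum_(m : 'X_{1..n < N}) `|c m| * r ^+ mdeg m.
Proof.
rewrite (@pnormwE N) => [|m]; last by rewrite mcoeff_trunc; case: ifP; rewrite ?eqxx.
by apply: eq_bigr => m _; rewrite mcoeff_trunc bmdeg.
Qed.

Lemma meval_trunc N c (x : 'I_n -> K) :
  (trunc N c).@[x] = \sum_(m : 'X_{1..n < N}) c m * \prod_(i < n) x i ^+ m i.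
Proof. by rewrite /trunc raddf_sum; apply: eq_bigr => m _; rewrite /= mevalZ mevalX. Qed.

End PolynomialNorm.

Lemma Cplx_archimedean (R : realType) (z : Cplx R) : 0 <= z ->
  exists N : nat, z <= N%:R.
Proof.
case: z => a b; rewrite lecE /= => /andP[/eqP b0 a0].
exists (Num.bound a); rewrite -(rmorph_nat (real_complex R)) lecE /= b0 eqxx /=.
by apply: ltW; apply: archi_boundP.
Qed.

Lemma Cplx_geometric_small (R : realType) (z e : Cplx R) : 0 <= z -> 0 < e ->
  exists N0, forall N, (N0 <= N)%N -> z / 2 ^+ N <= e.
Proof.
move=> z0 e0; have [|N0 zN0] := @Cplx_archimedean R (z / e).
  by rewrite divr_ge0 // ltW.
exists N0 => N N0N; rewrite ler_pdivrMr ?exprn_gt0 // mulrC -ler_pdivrMr //.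
apply: le_trans zN0 _; rewrite -natrX ler_nat.
by apply: leq_trans N0N _; apply: ltnW; apply: ltn_expl.
Qed.

(** * Quantitative power series expansions on polydiscs *)

Section Polydiscs.
Variables (R : realType) (n : nat).
Local Notation C := (Cplx R).
Local Notation Cn := 'rV[C]_n.

Definition polydisc (s : C) (x : Cn) := forall i, `|x ord0 i| <= s.

Lemma near0P (P : Cn -> Prop) :
  (\forall x \near (0 : Cn), P x) <->
  exists2 r : C, 0 < r & forall x, polydisc r x -> P x.
Proof.
split=> [/nbhs_ballP[e /= e0 eP]|[r r0 rP]].
  (* Half of [e], because polydiscs are closed and balls are open. *)
  exists (e / 2); first by rewrite divr_gt0.
  move=> x xe; apply: eP; split=> // i j; rewrite (ord1 i) mxE.
  rewrite -ball_normE /= sub0r normrN; apply: le_lt_trans (xe j) _.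
  by rewrite ltr_pdivrMr // mulr_natr mulr2n ltrDr.
apply/nbhs_ballP; exists r => //= x [_ xr]; apply: rP => i.
by have := xr ord0 i; rewrite mxE -ball_normE /= sub0r normrN => /ltW.
Qed.

Lemma polydiscW s r x : s <= r -> polydisc s x -> polydisc r x.
Proof. by move=> sr xs i; apply: le_trans sr. Qed.

(** The order on C is only partial, so [r * s / (r + s)] stands in for the minimum. *)
Lemma common_radius (r s : C) : 0 < r -> 0 < s ->
  exists t, [/\ 0 < t, t <= r & t <= s].
Proof.
move=> r0 s0; exists (r * s / (r + s)).
have rs := addr_gt0 r0 s0; split; first by rewrite divr_gt0 ?mulr_gt0.
  by rewrite ler_pdivrMr // ler_pM2l // lerDr ltW.
by rewrite ler_pdivrMr // mulrC ler_pM2l // lerDl ltW.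
Qed.

(* Quantitative form of power_series_at0; the tail estimate is homogeneous in s,
   which makes it stable under products and strong enough for uniqueness. *)
Definition series_on (f : Cn -> C) (c : 'X_{1..n} -> C) (r M : C) :=
  [/\ 0 < r, forall N, pnorm r (trunc N c) <= M &
      forall N s x, 0 <= s -> s <= r -> polydisc s x ->
        `|f x - (trunc N c).@[x ord0]| * r ^+ N <= M * s ^+ N].

Lemma series_on_ge0 f c r M : series_on f c r M -> 0 <= M.
Proof. by case=> r0 /(_ 0%N) rM _; apply: le_trans rM; apply: pnorm_ge0; apply: ltW. Qed.

Lemma series_onW f c r r' M : series_on f c r M -> 0 < r' -> r' <= r -> series_on f c r' M.
Proof.
move=> [r0 rM rf] r'0 r'r; split=> // [N|N s x s0 sr' xs].
  by apply: le_trans (rM N); apply: pnorm_mono => //; apply: ltW.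
apply: le_trans (rf N s x s0 (le_trans sr' r'r) xs).
by rewrite ler_wpM2l // lerXn2r // nnegrE ltW.
Qed.

Lemma series_on_eq f g c r M : series_on f c r M -> (forall x, polydisc r x -> f x = g x) ->
  series_on g c r M.
Proof.
move=> [r0 rM rf] fg; split=> // N s x s0 sr xs.
by rewrite -fg; [apply: rf | apply: polydiscW xs].
Qed.

Lemma series_on_norm_le f c r M x : series_on f c r M -> polydisc r x -> `|f x| <= M.
Proof.
(* At [N = 0] the truncation is empty, and the tail estimate is already the bound. *)
move=> [r0 rM rf] xr; have := rf 0%N r x (ltW r0) (lexx _) xr.
by rewrite meval_trunc big_pred0 ?subr0 ?mulr1 // => -[].
Qed.

(** Abel's lemma: absolute convergence at the single corner [(r, ..., r)] bounds the coefficients,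
    hence the tails uniformly on the polydisc. *)
Lemma power_series_on f c : power_series_at0 f c -> exists r M, series_on f c r M.
Proof.
move=> /near0P[r r0 fr]; exists r.
have [|[M rM] _] := fr (const_mx r); first by move=> i; rewrite mxE gtr0_norm.
have {}rM N : pnorm r (trunc N c) <= M.
  rewrite pnorm_trunc; apply: le_trans (rM N); apply: ler_sum => m _.
  rewrite normrM ler_wpM2l // /monomial_at mdegE (big_morph _ (exprD r) (expr0 r)).
  rewrite normr_prod; apply: ler_prod => i _; rewrite mxE.
  by rewrite normrX gtr0_norm // exprn_ge0 /= ?lexx ?ltW.
exists M; split=> // N s x s0 sr xs.
have [_ fx] := fr x (polydiscW sr xs).
apply/ler_addgt0Pr => e e0.
have rN0 : 0 < r ^+ N by rewrite exprn_gt0.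
have eN0 : 0 < e / r ^+ N by rewrite divr_gt0.
have /cvgrPdist_le/(_ _ eN0)[L0 _ fL] := fx.
pose L := maxn L0 N; have := fL L (leq_maxl _ _).
rewrite /= -meval_trunc => {}fL.
(* The truncation at [L >= N] is so far out that the second term is at most [e / r ^+ N]; the first
   has no monomial below degree [N], so [pnorm_high] applies. *)
rewrite (_ : f x - _ = (trunc L c - trunc N c).@[x ord0] +
    (f x - (trunc L c).@[x ord0])); last by rewrite mevalB; ring.
apply: le_trans (ler_wpM2r (ltW rN0) (ler_normD _ _)) _.
rewrite mulrDl lerD //; last by rewrite -ler_pdivlMr.
apply: le_trans (ler_wpM2r (ltW rN0) (norm_meval_le _ xs)) _.
apply: le_trans (pnorm_high s0 sr _) _.
  move=> m mN; rewrite mcoeffB !mcoeff_trunc mN ifT ?subrr //.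
  by apply: leq_trans mN _; rewrite leq_maxr.
rewrite ler_wpM2r ?exprn_ge0 //; apply: le_trans (rM L).
apply: pnorm_le; first exact: ltW.
move=> m; rewrite mcoeffB !mcoeff_trunc; case: ifP; case: ifP => mN mL.
- by rewrite subrr normr0.
- by rewrite subr0.
- by move: mL; rewrite (leq_trans mN) // leq_maxr.
- by rewrite subrr.
Qed.

Lemma series_on_power_series f c r M : series_on f c r M -> power_series_at0 f c.
Proof.
move=> frM; have [r0 rM fr] := frM; apply/near0P.
(* At the radius [r] itself the tail estimate gives no decay; at [r / 2] it gives [M / 2 ^+ N]. *)
have r20 : 0 < r / 2 by rewrite divr_gt0.
have r2r : r / 2 <= r by rewrite ler_pdivrMr // mulr_natr mulr2n lerDl ltW.
exists (r / 2) => // x xr; split.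
  exists M => N; apply: le_trans (rM N); rewrite pnorm_trunc.
  apply: ler_sum => m _; rewrite normrM ler_wpM2l // normr_prod mdegE.
  rewrite (big_morph _ (exprD r) (expr0 r)); apply: ler_prod => i _.
  rewrite normr_ge0 normrX lerXn2r // ?nnegrE ?(ltW r0) //.
  exact: le_trans r2r.
apply/cvgrPdist_le => e e0; have [N0 MN0] := Cplx_geometric_small (series_on_ge0 frM) e0.
exists N0 => //= N /= N0N; apply: le_trans (MN0 N N0N); rewrite -meval_trunc.
rewrite -(ler_pM2r (exprn_gt0 N r0)).
apply: le_trans (fr N _ x (ltW r20) r2r xr) _.
by rewrite expr_div_n mulrA mulrAC.
Qed.

Lemma series_on_near f g c r M : series_on f c r M -> (\forall x \near (0 : Cn), f x = g x) ->
  exists2 r', 0 < r' <= r & series_on g c r' M.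
Proof.
move=> frM /near0P[s s0 fg]; have r0 : 0 < r by case: frM.
have [t [t0 tr ts]] := common_radius r0 s0; exists t; first by rewrite t0.
by apply: series_on_eq (series_onW frM t0 tr) _ => x xt; apply/fg/(polydiscW ts).
Qed.

Lemma series_on_meval p r : 0 < r ->
  series_on (fun x => p.@[x ord0]) (fun m => p@_m) r (pnorm r p).
Proof.
move=> r0; have trunc_le N m : `|(trunc N (fun m => p@_m))@_m| <= `|p@_m|.
  exact: norm_mcoeff_trunc.
split=> // [N|N s x s0 sr xs]; first by apply: pnorm_le => //; apply: ltW.
rewrite -mevalB; apply: le_trans (ler_wpM2r _ (norm_meval_le _ xs)) _.
  by rewrite exprn_ge0 // ltW.
apply: le_trans (pnorm_high s0 sr _) _.
  by move=> m mN; rewrite mcoeffB mcoeff_trunc mN subrr.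
rewrite ler_wpM2r ?exprn_ge0 // pnorm_le ?ltW // => m.
by rewrite mcoeffB mcoeff_trunc; case: ifP; rewrite ?subrr ?normr0 ?subr0.
Qed.

Lemma truncB N c d : trunc N (fun m => c m - d m) = trunc N c - trunc N d :> {mpoly C[n]}.
Proof.
by apply/mpolyP => m; rewrite mcoeffB !mcoeff_trunc; case: ifP; rewrite ?subr0.
Qed.

Lemma series_onB f g c d r M1 M2 : series_on f c r M1 -> series_on g d r M2 ->
  series_on (fun x => f x - g x) (fun m => c m - d m) r (M1 + M2).
Proof.
move=> [r0 rM1 rf] [_ rM2 rg]; split=> // [N|N s x s0 sr xs].
  rewrite truncB; apply: le_trans (pnormD _ _ (ltW r0)) _; rewrite lerD //.
  apply: le_trans (rM2 N); apply: pnorm_le; first exact: ltW.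
  by move=> m; rewrite mcoeffN normrN.
rewrite truncB mevalB.
rewrite (_ : f x - g x - _ =
  (f x - (trunc N c).@[x ord0]) - (g x - (trunc N d).@[x ord0])); last by ring.
apply: le_trans (ler_wpM2r _ (ler_normB _ _)) _; first by rewrite exprn_ge0 // ltW.
by rewrite !mulrDl lerD ?rf ?rg.
Qed.

Lemma trunc_conv N c d m :
  (trunc N (conv c d))@_m =
  if (mdeg m < N)%N then (trunc N c * trunc N d : {mpoly C[n]})@_m else 0.
Proof.
rewrite mcoeff_trunc; case: ifP => // mN; apply/esym.
exact: (approxM (@approx_trunc _ _ N c) (@approx_trunc _ _ N d)).
Qed.

Lemma series_onM f g c d r M1 M2 : series_on f c r M1 -> series_on g d r M2 ->
  series_on (fun x => f x * g x) (conv c d) r (M1 * M2 *+ 3).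
Proof.
move=> frM grM; have [[r0 rM1 rf] [_ rM2 rg]] := (frM, grM).
have M10 := series_on_ge0 frM; have M20 := series_on_ge0 grM; have r0' := ltW r0.
have PQ N : pnorm r (trunc N c * trunc N d) <= M1 * M2.
  by apply: le_trans (pnormM _ _ r0') _; rewrite ler_pM ?pnorm_ge0.
have M12 : M1 * M2 <= M1 * M2 *+ 3.
  by rewrite mulrSr lerDr mulrn_wge0 // mulr_ge0.
split=> // [N|N s x s0 sr xs].
  apply: le_trans M12; apply: le_trans (PQ N); apply: pnorm_le => // m.
  by rewrite trunc_conv; case: ifP; rewrite ?normr0.
set P := trunc N c; set Q := trunc N d; set S := trunc N (conv c d).
(* Each of the three terms costs [M1 * M2], whence the factor 3: two tails, and a polynomial without
   monomials below degree [N]. *)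
rewrite (_ : f x * g x - _ = (f x - P.@[x ord0]) * g x + P.@[x ord0] * (g x - Q.@[x ord0])
  + (P * Q - S).@[x ord0]); last by rewrite mevalB mevalM; ring.
have rN0 : 0 <= r ^+ N by rewrite exprn_ge0.
apply: le_trans (ler_wpM2r rN0 (ler_normD _ _)) _.
rewrite mulrDl mulrSr [leRHS]mulrDl; apply: lerD; last first.
  apply: le_trans (ler_wpM2r rN0 (norm_meval_le _ xs)) _.
  apply: le_trans (pnorm_high s0 sr _) _.
    by move=> m mN; rewrite mcoeffB trunc_conv mN subrr.
  rewrite ler_wpM2r ?exprn_ge0 //; apply: le_trans (PQ N); apply: pnorm_le => // m.
  by rewrite mcoeffB trunc_conv; case: ifP; rewrite ?subrr ?normr0 ?subr0.
apply: le_trans (ler_wpM2r rN0 (ler_normD _ _)) _.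
rewrite mulr2n [leRHS]mulrDl mulrDl !normrM; apply: lerD.
  rewrite mulrAC [M1 * M2 * _]mulrAC ler_pM ?mulr_ge0 ?rf //.
  exact: series_on_norm_le grM (polydiscW sr xs).
rewrite -!mulrA ler_pM ?mulr_ge0 ?rg //.
by apply: le_trans (norm_meval_le P (polydiscW sr xs)) _; apply: rM1.
Qed.

(** The difference [e] expands the zero function. Were it nonzero, its lowest homogeneous part, of
    degree [D], would have exact size [t ^+ D] along some line, while the tail estimate allows only
    a multiple of [t ^+ D.+1]. *)
Lemma series_on_unique f c d r M1 M2 : series_on f c r M1 -> series_on f d r M2 -> c = d.
Proof.
move=> frM grM; pose e m := c m - d m; pose M := M1 + M2.
have erM : series_on (fun x => f x - f x) e r M := series_onB frM grM.
suff e0 m : e m = 0 by apply/funext => m; apply/eqP; rewrite -subr_eq0; apply/eqP; apply: e0.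
apply/eqP/negP => /negP em.
have [u [eu umin]] := lowest_exists (@mdeg n) (ex_intro (fun m => e m != 0) m em).
pose D := mdeg u; pose P : {mpoly C[n]} := trunc D.+1 e.
have PD k : P@_k != 0 -> mdeg k = D.
  rewrite mcoeff_trunc ltnS; case: ifP => [kD|_ /eqP//] /umin [|[]//].
  by rewrite ltnNge kD.
have [v Pv] : exists v : 'I_n -> C, P.@[v] != 0.
  apply: mpoly_nonvanishing; apply/eqP => /(congr1 (fun p => p@_u)).
  by rewrite mcoeff_trunc ltnSn mcoeff0 => /eqP; rewrite (negPf eu).
have homP t : P.@[fun i => t * v i] = t ^+ D * P.@[v].
  rewrite !mevalE mulr_sumr !big_seq; apply: eq_bigr => k.
  rewrite mcoeff_msupp => /PD kD; rewrite mulrCA; congr (_ * _).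
  rewrite -kD mdegE (big_morph _ (exprD t) (expr0 t)) -big_split /=.
  by apply: eq_bigr => i _; rewrite exprMn.
have [r0 _ er] := erM; have M0 := series_on_ge0 erM.
pose V := \sum_i `|v i| + 1; have V0 : 0 < V.
  by rewrite ltr_wpDl // sumr_ge0.
have vV i : `|v i| <= V.
  by rewrite /V (bigD1 i) //= -addrA lerDl addr_ge0 // sumr_ge0.
have Pv0 : 0 < `|P.@[v]| by rewrite normr_gt0.
have key t : 0 < t -> t * V <= r -> `|P.@[v]| * r ^+ D.+1 <= M * V ^+ D.+1 * t.
  move=> t0 tVr; have tV0 : 0 <= t * V by rewrite mulr_ge0 ?ltW.
  have xt : polydisc (t * V) (\row_i (t * v i)).
    by move=> i; rewrite mxE normrM gtr0_norm // ler_pM2l.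
  have := er D.+1 (t * V) (\row_i (t * v i)) tV0 tVr xt.
  rewrite subrr sub0r normrN -/P.
  rewrite (@meval_eq _ _ _ (fun i => t * v i)) => [|i]; last by rewrite mxE.
  have tD : 0 < t ^+ D by rewrite exprn_gt0.
  rewrite homP normrM (gtr0_norm tD) => H; rewrite -(ler_pM2l tD) mulrA.
  apply: le_trans H _; rewrite exprMn (exprSr t).
  by rewrite (_ : M * _ = t ^+ D * (M * V ^+ D.+1 * t)) //; ring.
pose A := `|P.@[v]| * r ^+ D.+1; pose B := M * V ^+ D.+1.
have A0 : 0 < A by rewrite mulr_gt0 ?exprn_gt0.
have B0 : 0 <= B by apply: mulr_ge0 M0 _; apply: exprn_ge0; apply: ltW.
have B10 : 0 < B + 1 by apply: ltr_wpDl.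
(* Here [key] yields [A <= B * t], and the last bound yields [2 * t * (B + 1) <= A]; together,
   [2 * A <= A]. The [+ 1] keeps the divisor positive when [B = 0]. *)
have [t [t0 tr tAB]] : exists t, [/\ 0 < t, t <= r / V & t <= A / (B + 1) / 2].
  by apply: common_radius; rewrite !divr_gt0.
have AB : A <= B * t by apply: key; rewrite // -ler_pdivlMr.
rewrite !ler_pdivlMr // in tAB.
have : A *+ 2 <= A.
  rewrite mulr2n (le_trans (lerD AB AB)) // (le_trans _ tAB) //.
  rewrite (_ : B * t + B * t = t * 2 * B); last by ring.
  by rewrite ler_pM2l ?mulr_gt0 // lerDl.
by rewrite mulr2n gerDl lt_geF.
Qed.

End Polydiscs.

Lemma conv_order (K : idomainType) n (c d : 'X_{1..n} -> K) A B m :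
  (forall k, (mdeg k < A)%N -> c k = 0) -> (forall k, (mdeg k < B)%N -> d k = 0) ->
  (mdeg m < A + B)%N -> conv c d m = 0.
Proof.
move=> cA dB mAB; apply/eqP/negPn/negP => /conv_neq0[k [l [mE ck dl]]].
have kA : (A <= mdeg k)%N by rewrite leqNgt; apply: contra ck => /cA ->.
have lB : (B <= mdeg l)%N by rewrite leqNgt; apply: contra dl => /dB ->.
by move: mAB; rewrite mE mdegD ltnNge leq_add.
Qed.

Lemma mcoeffX_order (K : idomainType) n (p : {mpoly K[n]}) k m :
  p@_0 = 0 -> (mdeg m < k)%N -> (p ^+ k)@_m = 0.
Proof.
move=> p0; elim: k m => [//|k IHk] m mk; rewrite exprS.
have := congr1 (@^~ m) (conv_mcoeff p (p ^+ k)); rewrite /= => <-.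
apply: (@conv_order _ _ _ _ 1 k) => // l; rewrite ltnS leqn0 mdeg_eq0.
by move=> /eqP ->.
Qed.

Lemma approxX (K : idomainType) n N (p q : {mpoly K[n]}) k :
  approx N p (fun m => q@_m) -> approx N (p ^+ k) (fun m => (q ^+ k)@_m).
Proof.
move=> pq; elim: k => [|k IHk] m mN; first by rewrite !expr0.
rewrite !exprS (approxM pq IHk mN); apply/esym.
by apply: (@approxM _ _ N q (q ^+ k)).
Qed.

Lemma pnormZ_le (K : numFieldType) n r a (p : {mpoly K[n]}) : 0 <= r ->
  pnorm r (a *: p) <= `|a| * pnorm r p.
Proof. by move=> r0; rewrite -mul_mpolyC -(pnormC n r a) pnormM. Qed.

(** * Inversion of series with nonzero constant term *)

Section Inverse.
Variables (R : realType) (n : nat).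
Local Notation C := (Cplx R).
Local Notation Cn := 'rV[C]_n.
Implicit Types (h : Cn -> C) (c : 'X_{1..n} -> C).

Variable c : 'X_{1..n} -> C.
Hypothesis c0 : c 0%MM != 0.

(* c = c(0) (1 - u), inverted by the geometric series. *)
Let u m : C := if m == 0%MM then 0 else - (c m / c 0%MM).
Let U N : {mpoly C[n]} := trunc N u.
Let S N : {mpoly C[n]} := (c 0%MM)^-1 *: \sum_(k < N) U N ^+ k.

(** Powers of [U] beyond [mdeg m] have no term at [m], so this partial sum already carries the final
    coefficient. *)
Definition inv_coef m : C := (S (mdeg m).+1)@_m.

Let U0 N : (U N)@_0 = 0.
Proof. by rewrite mcoeff_trunc /u eqxx; case: ifP. Qed.

Let approx_U N l : (l <= N)%N -> approx l (U N) (fun k => (U l)@_k).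
Proof.
move=> lN k kl; rewrite /U (@approx_trunc _ _ N u) ?(leq_trans kl) //.
by rewrite (@approx_trunc _ _ l u).
Qed.

Let approx_S N : approx N (S N) inv_coef.
Proof.
move=> m mN; have UU := approx_U mN.
rewrite /inv_coef; set l := (mdeg m).+1 in mN UU *.
rewrite /S !mcoeffZ; congr (_ * _); move: (U0 N) UU; move: (U N) (U l) => p q p0 pq.
rewrite -(big_mkord xpredT (fun k => p ^+ k)) (big_cat_nat (leq0n l) mN) /=.
rewrite mcoeffD big_mkord !raddf_sum /= big_nat_cond [X in _ + X]big1 ?addr0.
  by apply: eq_bigr => k _; apply: (approxX k pq); apply: ltnSn.
by move=> k /andP[/andP[lk _] _]; apply: mcoeffX_order.
Qed.

Let truncE N : (0 < N)%N -> trunc N c = c 0%MM *: (1 - U N) :> {mpoly C[n]}.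
Proof.
move=> N0; apply/mpolyP => m; rewrite mcoeffZ mcoeffB !mcoeff_trunc mcoeff1 /u.
have [->|m0] := eqVneq m 0%MM; first by rewrite mdeg0 N0 subr0 mulr1.
case: ifP => _; last by rewrite subr0 mulr0.
by rewrite sub0r opprK mulrCA divff ?mulr1.
Qed.

(** The geometric sum telescopes: what is left is [U N ^+ N], and [U N] has no constant term. *)
Let trunc_cS N m : (mdeg m < N)%N -> (1 - trunc N c * S N)@_m = 0.
Proof.
move=> mN; rewrite truncE ?(leq_ltn_trans _ mN) //.
rewrite /S -scalerAl -scalerAr scalerA divff // scale1r.
rewrite -[X in X * _]opprB mulNr -subrX1 opprB opprB addrCA subrr addr0.
exact: mcoeffX_order.
Qed.

(** The inverse is the pointwise [(h x)^-1] on a small polydisc; the geometric series is then shown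
    to be its expansion. *)
Lemma unit_germ_coef0 h r M : series_on h c r M -> unit_germ h.
Proof.
move=> hrM; split; first by exists c; apply: series_on_power_series hrM.
have [r0 rM _] := hrM; have M0 := series_on_ge0 hrM; pose a := c 0%MM.
have a0 : 0 < `|a| by rewrite normr_gt0.
(* The resulting bound [Mta] serves twice: it makes [pnorm t (U N)] at most 1/2, and it keeps [h x]
   within [|a| / 2] of [a]. *)
have [t [t0 tr tM]] : exists t, [/\ 0 < t, t <= r & t <= r * `|a| / (M + 1) / 2].
  by apply: common_radius; rewrite // !divr_gt0 ?mulr_gt0 // ltr_wpDl.
have Mta : M * t <= `|a| / 2 * r.
  apply: le_trans (_ : (M + 1) * t <= _); first by rewrite ler_wpM2r ?lerDl ?ltW.
  rewrite mulrC -ler_pdivlMr ?ltr_wpDl //.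
  by rewrite (_ : `|a| / 2 * r / (M + 1) = r * `|a| / (M + 1) / 2) //; ring.
have t0' := ltW t0; have [_ tMc th] := series_onW hrM t0 tr.
have rU N : pnorm r (U N) <= `|a|^-1 * M.
  apply: le_trans (_ : pnorm r (a^-1 *: trunc N c) <= _).
    apply: pnorm_le; first exact: ltW.
    move=> m; rewrite mcoeffZ !mcoeff_trunc; case: ifP => _; last by rewrite mulr0.
    by rewrite /u; case: ifP; rewrite ?normr0 // normrN mulrC.
  apply: le_trans (pnormZ_le _ _ (ltW r0)) _.
  by rewrite normfV ler_pM2l ?invr_gt0.
have tU N : pnorm t (U N) <= 2^-1.
  rewrite -(ler_pM2r r0); have := @pnorm_high _ _ r t 1 (U N) t0' tr.
  rewrite !expr1 => H; apply: le_trans (H _) _.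
    by move=> m; rewrite ltnS leqn0 mdeg_eq0 => /eqP ->.
  apply: le_trans (ler_wpM2r t0' (rU N)) _.
  by rewrite -mulrA ler_pdivrMl // mulrA.
have tS N : pnorm t (S N) <= 2 / `|a|.
  apply: le_trans (pnormZ_le _ _ t0') _; rewrite normfV mulrC ler_pM2r ?invr_gt0 //.
  apply: le_trans (pnorm_sum _ _ t0') _.
  apply: le_trans (_ : \sum_(k < N) 2^-1 ^+ k <= _).
    apply: ler_sum => k _; apply: le_trans (pnormX _ _ t0') _.
    by rewrite lerXn2r ?nnegrE ?pnorm_ge0 ?invr_ge0.
  have := subrX1 (2^-1 : C) N; set G := \sum_(k < N) _ => GE.
  rewrite (_ : G = 2 - 2 * 2^-1 ^+ N) ?gerBl ?mulr_ge0 ?exprn_ge0 ?invr_ge0 //.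
  have -> : G = -2 * ((2^-1 - 1) * G) by field.
  by rewrite -GE; ring.
have [M2 M2E] : exists M2 : C, M2 = 2 / `|a| by exists (2 / `|a|).
have M20 : 0 <= M2 by rewrite M2E divr_ge0 ?ltW.
have tD N : pnorm t (trunc N inv_coef) <= M2.
  rewrite M2E; apply: le_trans (tS N); apply: pnorm_le t0' _ => m; rewrite mcoeff_trunc.
  by case: ifP => [/approx_S->|_]; [exact: lexx | rewrite normr0].
have hlow x : polydisc t x -> `|a| / 2 <= `|h x|.
  move=> xt; have [_ _ /(_ 1%N t x t0' tr xt)] := hrM.
  have -> : trunc 1 c = a%:MP :> {mpoly C[n]}.
    apply/mpolyP => m; rewrite mcoeff_trunc mcoeffC ltnS leqn0 mdeg_eq0.
    by case: eqP => [->|]; rewrite ?mulr1 ?mulr0.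
  rewrite mevalC !expr1 => /le_trans/(_ Mta); rewrite ler_pM2r // => hxa.
  have := ler_distD (h x) a 0; rewrite !subr0 distrC => aE.
  rewrite -(lerD2l (`|a| / 2)) -splitr; apply: le_trans aE _.
  by rewrite lerD2r.
have h0 x : polydisc t x -> h x != 0.
  move=> /hlow hx; rewrite -normr_gt0; apply: lt_le_trans hx.
  by rewrite divr_gt0.
pose b x := (h x)^-1; exists b; split; last first.
  apply/near0P; exists t => // x /h0 hx; exact: divff.
(* The first summand bounds the tails, the added [M2] the norms of the truncations. *)
exists inv_coef; pose M3 := M2 * (M * M2 + (1 + M * M2)) + M2.
have M30 : 0 <= M2 * (M * M2 + (1 + M * M2)).
  have MM2 := mulr_ge0 M0 M20.
  exact: mulr_ge0 M20 (addr_ge0 MM2 (addr_ge0 ler01 MM2)).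
apply: (@series_on_power_series _ _ _ _ t M3); split=> // [N|N s x s0 st xs].
  by apply: le_trans (tD N) _; rewrite lerDr.
have xt := polydiscW st xs; set D := (trunc N inv_coef).@[x ord0].
have tN0 : 0 <= t ^+ N by rewrite exprn_ge0.
pose P : {mpoly C[n]} := 1 - trunc N c * trunc N inv_coef.
have PN m : (mdeg m < N)%N -> P@_m = 0.
  move=> mN; rewrite -(trunc_cS mN) !mcoeffB; congr (_ - _).
  rewrite (approxM (@approx_trunc _ _ N c) (@approx_trunc _ _ N inv_coef) mN).
  by rewrite (approxM (@approx_trunc _ _ N c) (@approx_S N) mN).
have tP : pnorm t P <= 1 + M * M2.
  apply: le_trans (pnormD _ _ t0') _; rewrite -mpolyC1 pnormC normr1 lerD2l.
  apply: le_trans (_ : pnorm t (trunc N c * trunc N inv_coef) <= _).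
    by apply: pnorm_le => // m; rewrite mcoeffN normrN.
  by apply: le_trans (pnormM _ _ t0') _; rewrite ler_pM ?pnorm_ge0.
(* Since [b x * h x = 1], the error splits into the residue [P], which has no term below degree [N],
   and the tail of [h]. *)
have -> : b x - D = b x * (P.@[x ord0] - (h x - (trunc N c).@[x ord0]) * D).
  rewrite /P mevalB meval1 mevalM -/D (_ : b x - D = b x - b x * h x * D); last first.
    by rewrite mulVf ?mul1r ?h0.
  by move: (b x) (h x) D (meval _ _) => ? ? ? ?; ring.
apply: le_trans (_ : M2 * (M * M2 + (1 + M * M2)) * s ^+ N <= _); last first.
  by rewrite ler_wpM2r ?exprn_ge0 // lerDl.
have bx : `|b x| <= M2.
  rewrite normfV -[M2]invrK lef_pV2 ?posrE ?normr_gt0 ?h0 //; last first.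
    by rewrite M2E invr_gt0 divr_gt0.
  by rewrite M2E invf_div hlow.
rewrite normrM -!mulrA ler_pM ?mulr_ge0 //.
apply: le_trans (ler_wpM2r tN0 (ler_normB _ _)) _;
rewrite addrC [leLHS]mulrDl [leRHS]mulrDl; apply: lerD.
  rewrite normrM mulrAC [leRHS]mulrAC ler_pM ?mulr_ge0 ?th //.
  exact: le_trans (norm_meval_le _ xt) _.
apply: le_trans (ler_wpM2r tN0 (norm_meval_le _ xs)) _.
apply: le_trans (pnorm_high s0 st PN) _.
by rewrite ler_wpM2r ?exprn_ge0.
Qed.

End Inverse.

(** * The germ t^b - f^2 *)

Section Suspension.
Variables (K : idomainType) (n : nat).
Implicit Types (c d : 'X_{1..n} -> K) (m : 'X_{1..n.+1}).

Definition mnm_init m : 'X_{1..n} := [multinom m (lift ord_max i) | i < n].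

Definition lift_coef c m : K := if m ord_max == 0%N then c (mnm_init m) else 0.

(** Reconciles [mwiden], which embeds the variables by [widen_ord], with [first_coords], which uses
    [lift ord_max]. *)
Lemma widen_lift (i : 'I_n) : widen_ord (leqnSn n) i = lift ord_max i.
Proof. by apply: val_inj; rewrite /= /bump leqNgt ltn_ord. Qed.

Lemma mnmwiden_init m : m ord_max = 0%N -> mnmwiden (mnm_init m) = m.
Proof.
move=> m0; apply/mnmP => i; case: (unliftP ord_max i) => [j ->|->].
  by rewrite -widen_lift mnmwiden_widen mnmE widen_lift.
by rewrite mnmwiden_ordmax m0.
Qed.

Lemma mnm_initK (k : 'X_{1..n}) : mnm_init (mnmwiden k) = k.
Proof. by apply/mnmP => i; rewrite mnmE -widen_lift mnmwiden_widen. Qed.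

Lemma lift_coef_widen c k : lift_coef c (mnmwiden k) = c k.
Proof. by rewrite /lift_coef mnmwiden_ordmax eqxx mnm_initK. Qed.

Lemma mdeg_mnmwiden (k : 'X_{1..n}) : mdeg (mnmwiden k) = mdeg k.
Proof.
rewrite !mdegE big_ord_recr /= mnmwiden_ordmax addn0.
by apply: eq_bigr => i _; rewrite mnmwiden_widen.
Qed.

Lemma mwiden_trunc N c : mwiden (trunc N c) = trunc N (lift_coef c) :> {mpoly K[n.+1]}.
Proof.
apply/mpolyP => m; rewrite mcoeff_trunc /lift_coef.
case: eqP => [m0|m0].
  by rewrite -{1}(mnmwiden_init m0) mwiden_mnmwiden mcoeff_trunc -mdeg_mnmwiden mnmwiden_init.
rewrite if_same /trunc (raddf_sum (@mwiden n K)) raddf_sum big1 //= => k _.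
rewrite mwidenZ mwidenX mcoeffZ mcoeffX; case: eqP => [km|_]; last by rewrite mulr0.
by case: m0; rewrite -km mnmwiden_ordmax.
Qed.

End Suspension.

(** * Square factors and the derivative in the last variable *)

Section Derivation.
Variables (K : idomainType) (n : nat).
Implicit Types (c : 'X_{1..n} -> K).

Definition dcoef (i : 'I_n) c (m : 'X_{1..n}) : K := c (m + U_(i))%MM *+ (m i).+1.

Lemma approx_deriv i N (p : {mpoly K[n]}) c :
  approx N.+1 p c -> approx N p^`M(i) (dcoef i c).
Proof.
move=> pc m mN; rewrite mcoeff_deriv pc // mdegD mdeg1 addn1 ltnS //.
Qed.

(** Leibniz rule: (h^2 q)' = h (2 h' q + h q'). The truncations are taken at [N.+1] because a
    derivative loses one degree. *)
Lemma dcoef_square i (h q : 'X_{1..n} -> K) : exists a,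
  conv h a = dcoef i (conv (conv h h) q).
Proof.
pose dh := dcoef i h; pose dq := dcoef i q.
exists (fun m => conv (fun k => dh k + dh k) q m + conv h dq m).
apply/funext => m; pose N := (mdeg m).+1.
have hN := @approx_trunc K n N.+1 h; have qN := @approx_trunc K n N.+1 q.
move: (trunc N.+1 h) (trunc N.+1 q) hN qN => H Q hN qN.
have dhN := approx_deriv i hN; have dqN := approx_deriv i qN.
have {}hN' := approxW (leqnSn N) hN; have {}qN' := approxW (leqnSn N) qN.
have L := approxM hN' (approxD (approxM (approxD dhN dhN) qN') (approxM hN' dqN)).
have D := approx_deriv i (approxM (approxM hN hN) qN).
rewrite -(L m (ltnSn _)) -(D m (ltnSn _)); congr (mcoeff m _).
by rewrite !mderivM; move: (mderiv i H) (mderiv i Q) => H' Q'; ring.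
Qed.

End Derivation.

Section Squarefree.
Variables (K : numFieldType) (n : nat).
Implicit Types (c : 'X_{1..n} -> K).

Definition cusp_coef b c (m : 'X_{1..n.+1}) : K :=
  ('X_[U_(ord_max) *+ b] : {mpoly K[n.+1]})@_m - lift_coef (conv c c) m.

Lemma square_factor_unit b c (h q : 'X_{1..n.+1} -> K) : (0 < b)%N ->
  (exists m, c m != 0) -> conv (conv h h) q = cusp_coef b c -> h 0%MM != 0.
Proof.
case: b => // b _ exc hhq; pose t : 'I_n.+1 := ord_max.
(* If every term of [h] involved [t], so would every term of the product; but the lowest term of [c]
   squares to a [t]-free term of [cusp_coef]. *)
have [[m0 hm0 m0t]|h_t] := pselect (exists2 m, h m != 0 & m t = 0%N); last first.
  have [u lowu] := lowest_exists (@mdeg n) exc.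
  have : cusp_coef b.+1 c (mnmwiden (u + u)) != 0.
    rewrite /cusp_coef lift_coef_widen (lowest_conv _ lowu lowu); last exact: mdegD.
    rewrite mcoeffX; case: (_ =P mnmwiden _) => [/(congr1 (fun k : 'X_{1..n.+1} => k t)) /=|_].
      by rewrite mnmwiden_ordmax mulmnE mnm1E eqxx.
    by rewrite sub0r oppr_eq0 mulf_neq0 //; case: lowu.
  rewrite -hhq => /conv_neq0[k [l [klE /conv_neq0[k1 [k2 [kE hk1 _]]] _]]].
  case: h_t; exists k1 => //.
  have := congr1 (fun w : 'X_{1..n.+1} => w t) klE; rewrite /=.
  by rewrite kE mnmwiden_ordmax !mnmDE; case: (k1 t).
have [a ha] := dcoef_square t h q.
(* The derivative kills the [t]-free part. After the case split the exponent of [t] is [b.+1], so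
   the derivative is a multiple of [t^b], nonzero in characteristic zero. *)
have dE m : conv h a m = if m == (U_(t) *+ b)%MM then b.+1%:R else 0.
  rewrite ha hhq /dcoef /cusp_coef /lift_coef mnmDE mnm1E eqxx addn1 subr0.
  rewrite mcoeffX mulmSr eqm_add2r eq_sym.
  case: eqP => [->|_]; last by rewrite mul0rn.
  by rewrite mulmnE mnm1E eqxx mul1n.
have [v lowv] : exists v, lowest (fun m : 'X_{1..n.+1} => m t) a v.
  apply: lowest_exists.
  have : conv h a (U_(t) *+ b)%MM != 0 by rewrite dE eqxx pnatr_eq0.
  by move=> /conv_neq0[_ [l [_ _ al]]]; exists l.
(* With the exponent of [t] as weight, the term [m0] forces [u] to be [t]-free. As [u + v] must be a
   power of [t], this leaves [u = 0]. *)
have [u lowu] := lowest_exists (fun m : 'X_{1..n.+1} => m t) (ex_intro (fun m => h m != 0) m0 hm0).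
have ut : u t = 0%N.
  case: lowu => _ /(_ m0 hm0); rewrite m0t; case=> [//|[//]].
have : conv h a (u + v)%MM != 0.
  rewrite (lowest_conv _ lowu lowv) => [|m k]; last by rewrite mnmDE.
  by rewrite mulf_neq0 //; [case: lowu | case: lowv].
rewrite dE; case: (_ =P (U_(t) *+ b)%MM) => [uvE _|_]; last by rewrite eqxx.
suff -> : 0%MM = u by case: lowu.
apply/mnmP => i; rewrite mnm0E; have [->|it] := eqVneq i t; first by rewrite ut.
have := congr1 (fun k : 'X_{1..n.+1} => k i) uvE.
rewrite /= mnmDE mulmnE mnm1E eq_sym (negPf it) mul0n.
by case: (u i).
Qed.

End Squarefree.

Lemma series_on_coef_unique (R : realType) n (f g : 'rV[Cplx R]_n -> Cplx R)
  (c d : 'X_{1..n} -> Cplx R) r s M1 M2 :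
  series_on f c r M1 -> series_on g d s M2 ->
  (\forall x \near (0 : 'rV[Cplx R]_n), f x = g x) -> c = d.
Proof.
move=> frM gsM /(series_on_near frM)[r' /andP[r'0 _] gr'M].
have s0 : 0 < s by case: gsM.
have [t [t0 tr ts]] := common_radius r'0 s0.
exact: series_on_unique (series_onW gr'M t0 tr) (series_onW gsM t0 ts).
Qed.

Lemma series_on_coef_neq0 (R : realType) n (f : 'rV[Cplx R]_n -> Cplx R)
  (c : 'X_{1..n} -> Cplx R) r M :
  series_on f c r M -> ~ (\forall x \near (0 : 'rV[Cplx R]_n), f x = 0) ->
  exists m, c m != 0.
Proof.
move=> frM f0; apply: contrapT => no; apply: f0.
apply: filterS (series_on_power_series frM) => x [_].
rewrite (_ : (fun N => _) = fun=> 0) => [cv|]; last first.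
  apply/funext => N; rewrite big1 // => m _.
  have [->|cm] := eqVneq (c m) 0; first by rewrite mul0r.
  by case: no; exists m.
apply/esym; apply: (cvg_unique _ _ cv); first exact: norm_hausdorff.
exact: cvg_cst.
Qed.

Lemma taylor_coefE (R : realType) n (f : 'rV[Cplx R]_n -> Cplx R) c r M :
  series_on f c r M -> taylor_coef f = c.
Proof.
move=> frM; have : power_series_at0 f (taylor_coef f).
  rewrite /taylor_coef; apply: (@xgetPex _ _ [set c | power_series_at0 f c]).
  by exists c; apply: series_on_power_series frM.
move=> /power_series_on[s [M' fsM]]; apply: series_on_coef_unique fsM frM _.
exact: (@filterE _ (nbhs (0 : 'rV[Cplx R]_n))).
Qed.

Section CuspGerm.
Variables (R : realType) (n : nat).
Local Notation C := (Cplx R).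

Lemma meval_mwiden (p : {mpoly C[n]}) (v : 'I_n.+1 -> C) :
  (mwiden p).@[v] = p.@[fun i => v (lift ord_max i)].
Proof.
rewrite [p in LHS]mpolyE (raddf_sum (@mwiden n C)) raddf_sum mevalE /=.
apply: eq_bigr => m _; rewrite mwidenZ mwidenX mevalZ mevalX big_ord_recr /=.
rewrite mnmwiden_ordmax expr0 mulr1; congr (_ * _); apply: eq_bigr => i _.
by rewrite mnmwiden_widen widen_lift.
Qed.

Lemma series_on_lift (f : 'rV[C]_n -> C) c r M : series_on f c r M ->
  series_on (fun x => f (first_coords x)) (lift_coef c) r M.
Proof.
move=> [r0 rM fr]; split=> // [N|N s x s0 sr xs]; rewrite -mwiden_trunc.
  apply: le_trans (rM N); rewrite pnorm_trunc /trunc (raddf_sum (@mwiden n C)) /=.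
  apply: le_trans (pnorm_sum _ _ (ltW r0)) _; apply: ler_sum => m _.
  by rewrite mwidenZ mwidenX pnorm_monomial mdeg_mnmwiden.
rewrite meval_mwiden (@meval_eq _ _ _ (first_coords x ord0)) => [|i].
  by apply: fr => // i; rewrite mxE.
by rewrite mxE.
Qed.

(* Through first_coords and ord_max, C^(n+1) is C^n x C with coordinates (y, t);
   this is the germ t^b - f(y)^2. *)
Definition cusp b (f : 'rV[C]_n -> C) (x : 'rV[C]_n.+1) : C :=
  x ord0 ord_max ^+ b - f (first_coords x) ^+ 2.

Lemma series_on_cusp b f c r M : series_on f c r M ->
  exists M', series_on (cusp b f) (cusp_coef b c) r M'.
Proof.
move=> frM; have r0 : 0 < r by case: frM.
have ffrM := series_on_lift (series_onM frM frM).
eexists; apply: series_on_eq (series_onB (series_on_meval _ r0) ffrM) _ => x _ /=.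
by rewrite /cusp -expr2 -mpolyXn rmorphXn /= mevalXU.
Qed.

Lemma cusp_coef_widen b (c : 'X_{1..n} -> C) m : (0 < b)%N ->
  cusp_coef b c (mnmwiden m) = - conv c c m.
Proof.
move=> b0; rewrite /cusp_coef lift_coef_widen mcoeffX.
case: (_ =P mnmwiden _) => [/(congr1 (fun k : 'X_{1..n.+1} => k ord_max)) /=|_].
  by rewrite mnmwiden_ordmax mulmnE mnm1E eqxx mul1n => b0'; rewrite b0' in b0.
by rewrite sub0r.
Qed.

(** A squared factor has nonzero constant term by [square_factor_unit], so it is a unit and not
    irreducible. *)
Lemma reduced_cusp b f : (0 < b)%N -> reduced_germ f -> reduced_germ (cusp b f).
Proof.
move=> b0 [[c /power_series_on[r [M frM]]] f0 fn0 _].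
have [M' FrM'] := series_on_cusp b frM; have exc := series_on_coef_neq0 frM fn0.
split.
- by exists (cusp_coef b c); apply: series_on_power_series FrM'.
- by rewrite /cusp first_coords0 f0 mxE !expr0n eqn0Ngt b0 subr0.
(* A vanishing germ would have the coefficients of the zero polynomial, against the nonzero
   coefficient at [u + u]. *)
- move=> F0; have := series_on_coef_unique FrM' (series_on_meval 0 (ltr01 : 0 < (1 : C))).
  move=> /(_ _)-/(_ _) FE; have [u lowu] := lowest_exists (@mdeg n) exc.
  have : conv c c (u + u)%MM != 0.
    by rewrite (lowest_conv _ lowu lowu) ?mulf_neq0 //; [case: lowu|case: lowu|exact: mdegD].
  rewrite -oppr_eq0 -(cusp_coef_widen _ _ b0) FE ?mcoeff0 ?eqxx //.
  by apply: filterS F0 => x ->; rewrite meval0.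
- move=> h q [[ch hch] _ hnu _] [cq qcq] Fhq.
  have [r1 [M1 hr1]] := power_series_on hch.
  have [r2 [M2 qr2]] := power_series_on qcq.
  apply: hnu; apply: (unit_germ_coef0 _ hr1).
  apply: (square_factor_unit b0 exc).
  have [r10 r20] : 0 < r1 /\ 0 < r2 by case: hr1; case: qr2.
  have [t [t0 tr1 tr2]] := common_radius r10 r20.
  have ht := series_onW hr1 t0 tr1.
  have hq := series_onM (series_onM ht ht) (series_onW qr2 t0 tr2).
  by apply: series_on_coef_unique hq FrM' _; apply: filterS Fhq => x ->; rewrite expr2.
Qed.

End CuspGerm.

(** * Multiplicities and initial forms *)

Section Multiplicity.
Variables (R : realType) (n : nat).
Local Notation C := (Cplx R).
Implicit Types f : 'rV[C]_n -> C.

Lemma mcoeff_homogeneous_part f k m :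
  (homogeneous_part f k)@_m = if mdeg m == k then taylor_coef f m else 0.
Proof.
rewrite (_ : homogeneous_part f k =
    trunc k.+1 (fun m => if mdeg m == k then taylor_coef f m else 0)).
  by rewrite mcoeff_trunc; case: eqP => [->|_]; rewrite ?ltnSn // if_same.
rewrite /homogeneous_part big_mkcond; apply: eq_bigr => l _ /=.
by case: eqP => // _; rewrite scale0r.
Qed.

Lemma multiplicityP f k : homogeneous_part f k != 0 ->
  homogeneous_part f (multiplicity f) != 0 /\
  forall j, (j < multiplicity f)%N -> homogeneous_part f j = 0.
Proof.
move=> fk; rewrite /multiplicity.
apply: (@xgetPex _ 0%N [set m | homogeneous_part f m != 0 /\
   forall k, (k < m)%N -> homogeneous_part f k = 0]).
case: (ex_minnP (ex_intro (fun k => homogeneous_part f k != 0) k fk)) => m fm mmin.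
exists m; split=> // j; rewrite ltnNge => jm.
by apply/eqP/negPn; apply: contra jm => /mmin.
Qed.

Lemma multiplicity_le f k : homogeneous_part f k != 0 -> (multiplicity f <= k)%N.
Proof.
move=> fk; have [_ low] := multiplicityP fk; rewrite leqNgt; apply/negP => /low.
by move/eqP: fk.
Qed.

Lemma multiplicityE f k : homogeneous_part f k != 0 ->
  (forall j, (j < k)%N -> homogeneous_part f j = 0) -> multiplicity f = k.
Proof.
move=> fk low; apply/eqP; rewrite eqn_leq multiplicity_le //= leqNgt.
by apply/negP => /low/eqP; have [/negPf ->] := multiplicityP fk.
Qed.

Lemma lowest_multiplicity f u :
  lowest (@mdeg n) (taylor_coef f) u -> mdeg u = multiplicity f.
Proof.
move=> [fu umin]; apply/esym/multiplicityE => [|j ju].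
  apply/eqP => /(congr1 (fun p => p@_u)); rewrite mcoeff_homogeneous_part eqxx mcoeff0.
  exact/eqP.
apply/mpolyP => m; rewrite mcoeff_homogeneous_part mcoeff0; case: eqP => // mj.
apply/eqP/negPn/negP => /umin; rewrite mj => -[uj|[uj _]].
  by have := ltn_trans uj ju; rewrite ltnn.
by rewrite uj ltnn in ju.
Qed.

Lemma msize_initial_form f : (msize (initial_form f) <= (multiplicity f).+1)%N.
Proof.
rewrite msizeE; apply/bigmax_leqP_seq => m; rewrite mcoeff_msupp.
by rewrite mcoeff_homogeneous_part; case: (mdeg m =P _) => [->//|_]; rewrite eqxx.
Qed.

End Multiplicity.

Section CuspMultiplicity.
Variables (R : realType) (n : nat).
Local Notation C := (Cplx R).
Variable f : 'rV[C]_n -> C.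
Hypothesis redf : reduced_germ f.

Let taylor_cusp b : taylor_coef (cusp b f) = cusp_coef b (taylor_coef f).
Proof.
case: redf => -[c /power_series_on[r [M frM]]] _ _ _.
by have [M' FrM'] := series_on_cusp b frM; rewrite (taylor_coefE FrM') (taylor_coefE frM).
Qed.

Let lowest_f : exists u, lowest (@mdeg n) (taylor_coef f) u.
Proof.
case: redf => -[c /power_series_on[r [M frM]]] _ f0 _; apply: lowest_exists.
by rewrite (taylor_coefE frM); apply: series_on_coef_neq0 frM f0.
Qed.

(** The lowest term of [f], squared, is free of [t] and cannot cancel against [t^b]; this bounds the
    multiplicity of the cusp for every positive [b]. *)
Lemma cusp_homogeneous_part_neq0 b : (0 < b)%N ->
  homogeneous_part (cusp b f) (multiplicity f).*2 != 0.
Proof.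
move=> b0; have [u lowu] := lowest_f.
apply/eqP => /(congr1 (fun p => p@_(mnmwiden (u + u)))).
rewrite mcoeff_homogeneous_part mcoeff0 mdeg_mnmwiden mdegD (lowest_multiplicity lowu).
rewrite addnn eqxx taylor_cusp cusp_coef_widen // (lowest_conv _ lowu lowu); last exact: mdegD.
by apply/eqP; rewrite oppr_eq0 mulf_neq0 //; case: lowu.
Qed.

Lemma cusp_initial_form b : (b < (multiplicity f).*2)%N ->
  initial_form (cusp b f) = 'X_[U_(ord_max) *+ b].
Proof.
move=> bm; have partE k : (k <= b)%N -> homogeneous_part (cusp b f) k =
    if k == b then 'X_[U_(ord_max) *+ b] else 0.
  move=> kb; apply/mpolyP => m; rewrite mcoeff_homogeneous_part taylor_cusp.
  have -> : (if k == b then 'X_[U_(ord_max) *+ b] else 0 : {mpoly C[n.+1]})@_m =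
      if mdeg m == k then ('X_[U_(ord_max) *+ b] : {mpoly C[n.+1]})@_m else 0.
    case: (eqVneq k b) => [->|kb']; case: (eqVneq (mdeg m) _) => [mk|mk]; rewrite ?mcoeff0 //.
      rewrite mcoeffX; case: (_ =P m) => // mE.
      by rewrite -mE mdegMn mdeg1 mul1n eqxx in mk.
    rewrite mcoeffX; case: (_ =P m) => // mE.
    by rewrite -mk -mE mdegMn mdeg1 mul1n eqxx in kb'.
  case: (eqVneq (mdeg m) k) => // mk; rewrite /cusp_coef /lift_coef.
  case: eqP => [m0|]; last by rewrite subr0.
  have low l : (mdeg l < multiplicity f)%N -> taylor_coef f l = 0.
    have [u lowu] := lowest_f; rewrite -(lowest_multiplicity lowu) => lu.
    apply/eqP/negPn/negP; case: lowu => _ umin /umin[|[ul _]].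
      by move=> /(ltn_trans lu); rewrite ltnn.
    by rewrite ul ltnn in lu.
  rewrite (conv_order low low) ?subr0 // addnn -(mdeg_mnmwiden (mnm_init m)).
  by rewrite mnmwiden_init // mk (leq_ltn_trans kb).
have X0 : 'X_[U_(ord_max) *+ b] != 0 :> {mpoly C[n.+1]}.
  by rewrite -msize_poly_eq0 msizeX.
rewrite /initial_form (@multiplicityE _ _ _ b) ?partE ?eqxx // => j jb.
by rewrite (partE _ (ltnW jb)) (ltn_eqF jb).
Qed.

End CuspMultiplicity.

(** * Relative multiplicities *)

Section Factorizations.
Variables (R : realType) (n : nat).
Local Notation C := (Cplx R).
Implicit Types p q : {mpoly C[n]}.

(** Leading monomials add up under products, so that of a unit must be trivial. *)
Lemma mlead_unit p : p != 0 -> (p \is a GRing.unit) = (mlead p == 0%MM).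
Proof.
move=> p0; apply/idP/eqP => [/unitrP[q [qp _]]|p1].
  have q0 : q != 0 by apply: contra_eq_neq qp => ->; rewrite mul0r eq_sym oner_eq0.
  have := mleadM q0 p0; rewrite qp mlead1 => /esym/eqP.
  by rewrite mnmD_eq0 => /andP[_ /eqP].
have /msize_poly1P[c c0 ->] : msize p == 1%N by rewrite -mlead_deg // p1 mdeg0.
by rewrite rmorph_unit // unitfE.
Qed.

(** A nonunit factor has degree at least one, so its exponent is at most the degree of [p], and
    [msize] is the degree plus one. *)
Lemma factor_exponent_le p r (h : 'I_r -> {mpoly C[n]}) k i :
  p != 0 -> factorization p h k -> (k i < msize p)%N.
Proof.
move=> p0 [irr _ _ pE]; move: (p0); rewrite {1}pE (bigD1 i) //= mulf_eq0 negb_or.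
move=> /andP[hk0 q0]; have [hi0 hiu _] := irr i.
rewrite -mlead_deg // pE (bigD1 i) //= mleadM // mdegD mleadX // mdegMn ltnS.
apply: leq_trans (leq_addr _ _); rewrite leq_pmull // lt0n mdeg_eq0.
by rewrite -mlead_unit.
Qed.

Lemma relative_multiplicity_lt (f : 'rV[C]_n -> C) X : initial_form f != 0 ->
  (relative_multiplicity f X < msize (initial_form f))%N.
Proof.
move=> f0; rewrite /relative_multiplicity; case: xgetP => [d _|_].
  by move=> [r [h [k [i [fac _ ->]]]]]; apply: factor_exponent_le fac.
by rewrite lt0n msize_poly_eq0.
Qed.

Lemma irreducible_mpolyX i : irreducible_mpoly ('X_i : {mpoly C[n]}).
Proof.
have X0 : 'X_i != 0 :> {mpoly C[n]} by rewrite -msize_poly_eq0 msizeX.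
split=> //; first by rewrite mlead_unit // mleadXm -mdeg_eq0 mdeg1.
move=> a b Xab; have := X0; rewrite Xab mulf_eq0 negb_or => /andP[a0 b0].
have := congr1 (@mdeg n) (mleadM a0 b0).
rewrite -Xab mleadXm mdeg1 mdegD !mlead_unit // -!mdeg_eq0.
by case: (mdeg _) => [|k]; [left | case: (mdeg _) => [|l]; [right | rewrite addSn addnS]].
Qed.

(** By [mdivisor_monomial], [p] is a scalar times a power of ['X_i]; exponent 0 gives a unit, and an
    exponent above 1 a proper factorization. *)
Lemma irreducible_monomial_factor i b (p q : {mpoly C[n]}) : irreducible_mpoly p ->
  p * q = 'X_[U_(i) *+ b] -> exists2 c, c != 0 & p = c *: 'X_i.
Proof.
move=> [p0 pu pirr]; rewrite -[RHS]scale1r => /(mdivisor_monomial (oner_neq0 _)).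
move=> [c [u [c0 pE [v uvE]]]].
have X0 m : 'X_[m] != 0 :> {mpoly C[n]} by rewrite -msize_poly_eq0 msizeX.
have [e uE] : exists e, u = (U_(i) *+ e)%MM.
  exists (u i); apply/mnmP => j; rewrite mulmnE mnm1E.
  case: eqP => [->|/eqP ij]; first by rewrite mul1n.
  have := congr1 (fun w : 'X_{1..n} => w j) uvE.
  rewrite /= mnmDE mulmnE mnm1E (negPf ij) mul0n => /esym/eqP.
  by rewrite addn_eq0 => /andP[/eqP].
exists c => //; rewrite {}uE {uvE} in pE.
case: e pE => [|[|e]] pE; last first.
- have : p = (c *: 'X_i) * 'X_[U_(i) *+ e.+1].
    by rewrite pE mulmS mpolyXD scalerAl.
  move=> /pirr[]; rewrite mlead_unit ?X0 //.
  + by rewrite mleadZ // mleadXm -mdeg_eq0 mdeg1.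
  + by rewrite -msize_poly_eq0 msizeZ // msizeX.
  + by rewrite mleadXm -mdeg_eq0 mdegMn mdeg1.
- by rewrite pE mulm1n.
- by move: pu; rewrite (mlead_unit p0) pE (mleadZ _ c0) mleadXm mulm0n eqxx.
Qed.

(** Every factor is associate to ['X_i], so pairwise non-association leaves a single one, and
    degrees give the exponent. Hence the choice made in [relative_multiplicity] is harmless here. *)
Lemma monomial_factorization i b r (h : 'I_r -> {mpoly C[n]}) k j :
  factorization 'X_[U_(i) *+ b] h k -> k j = b.
Proof.
move=> [irr kpos nassoc XE].
have hX l : exists2 c, c != 0 & h l = c *: 'X_i.
  pose q := h l ^+ (k l).-1 * \prod_(l' < r | l' != l) h l' ^+ k l'.
  apply: (@irreducible_monomial_factor i b _ q (irr l)).
  by rewrite XE (bigD1 l) //= mulrA -exprS prednK.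
have only l : l = j.
  apply/eqP/negPn/negP => lj; apply: (nassoc l j lj).
  have [[c c0 hl] [d d0 hj]] := (hX l, hX j).
  exists (d / c)%:MP; first by rewrite rmorph_unit // unitfE mulf_neq0 ?invr_eq0.
  by rewrite hl hj mul_mpolyC scalerA divfK.
have [hj0 _ _] := irr j; have [c c0 hj] := hX j.
have := congr1 (fun p => mdeg (mlead p)) XE.
rewrite /= (bigD1 j) //= big1 ?mulr1 => [|l]; last by rewrite (only l) eqxx.
rewrite mleadX // hj mleadZ // !mleadXm !mdegMn !mdeg1 !mul1n; exact: esym.
Qed.

Lemma zero_locusX i b : (0 < b)%N ->
  zero_locus ('X_[U_(i) *+ b] : {mpoly C[n]}) = zero_locus 'X_i.
Proof.
move=> b0; apply/seteqP; split=> x; rewrite /zero_locus /= -mpolyXn rmorphXn /= => /eqP.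
  by rewrite expf_eq0 b0 => /eqP.
by move=> /eqP ->; rewrite expr0n eqn0Ngt b0.
Qed.

Lemma relative_multiplicity_monomial (f : 'rV[C]_n -> C) i b : (0 < b)%N ->
  initial_form f = 'X_[U_(i) *+ b] ->
  relative_multiplicity f (tangent_cone f) = b.
Proof.
move=> b0 fE; rewrite /relative_multiplicity /tangent_cone fE.
case: xgetP => [d _|no].
  by move=> [r [h [k [j [fac _ ->]]]]]; apply: monomial_factorization fac.
(* The factorization with one factor rules out the default value 0. *)
case: (no b); exists 1%N, (fun=> 'X_i), (fun=> b), ord0; split=> //.
  split=> //; first by move=> _; apply: irreducible_mpolyX.
    by move=> j l; rewrite !ord1.
  by rewrite big_ord1 mpolyXn.
exact: zero_locusX.
Qed.

Lemma linear_zero_locusX i : linear_subspace (zero_locus ('X_i : {mpoly C[n]})).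
Proof.
exists (lker (linfun (col i : 'rV[C]_n -> 'cV[C]_1))).
apply/seteqP; split=> x; rewrite /zero_locus /= mevalXU memv_ker lfunE /=.
  by move=> xi; apply/eqP/matrixP => j l; rewrite !mxE (ord1 j).
by move=> /eqP/matrixP/(_ ord0 ord0); rewrite !mxE.
Qed.

End Factorizations.

(** The product with the identity fixes [t], so [t^b] is carried along unchanged. The chosen
    representative of the suspended germ agrees with [times_id] only near 0, hence the intersection
    of two neighbourhoods. *)
Lemma comp_germ_cusp (R : realType) n b (f g : 'rV[Cplx R]_n -> Cplx R)
  (phi : homeo_germ R n) :
  comp_germ f g phi -> comp_germ (cusp b f) (cusp b g) (times_id_germ phi).
Proof.
move=> fg; rewrite /comp_germ; set psi := repr (times_id_germ phi).
have psiE : \forall x \near (0 : 'rV[Cplx R]_n.+1), psi x = times_id (repr phi) x.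
  by apply/asboolP; apply/(@eqquotP _ _ (homeo_germ R n.+1)); rewrite reprK.
have fg' : \forall x \near (0 : 'rV[Cplx R]_n.+1),
    f (first_coords x) = g (repr phi (first_coords x)).
  move: fg; rewrite /comp_germ -{1}first_coords0.
  by move=> /(@first_coords_continuous _ _ (0 : 'rV[Cplx R]_n.+1)).
apply: filterS2 psiE fg' => x -> fx.
by rewrite /cusp /= first_times_id fx mxE unlift_none.
Qed.

Lemma multiplicity_cusp_bound (R : realType) n (f g : 'rV[Cplx R]_n -> Cplx R) :
  reduced_germ f -> reduced_germ g -> (multiplicity f < multiplicity g)%N ->
  let b := (multiplicity f).*2.+1 in
  linear_subspace (tangent_cone (cusp b g)) /\
  (relative_multiplicity (cusp b f) (tangent_cone (cusp b f)) <
   relative_multiplicity (cusp b g) (tangent_cone (cusp b g)))%N.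
Proof.
move=> redf redg fg b; have bg : (b < (multiplicity g).*2)%N by rewrite ltn_Sdouble.
have gE := cusp_initial_form redg bg; split.
  by rewrite /tangent_cone gE zero_locusX //; apply: linear_zero_locusX.
rewrite (relative_multiplicity_monomial _ gE) //.
have f0 := cusp_homogeneous_part_neq0 redf (ltn0Sn _ : 0 < b)%N.
have [F0 _] := multiplicityP f0.
(* It remains to see [msize <= b]: [msize] is at most the multiplicity of the cusp plus one, hence
   at most [(multiplicity f).*2.+1]. *)
apply: leq_trans (relative_multiplicity_lt _ F0) _.
by apply: leq_trans (msize_initial_form _) _; rewrite ltnS multiplicity_le.
Qed.

Theorem theorem2p7 (R : realType) (n : nat)
  (f g : 'rV[Cplx R]_n.+1 -> Cplx R)
  (T : set (homeo_germs R)) :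
  reduced_germ f -> reduced_germ g ->
  invariant_set T ->
  (forall phi : homeo_germs R, T phi ->
     weakly_preserves_relative_multiplicities (projT2 phi)) ->
  (exists phi : homeo_germ R n.+1,
     T (existT (fun k => homeo_germ R k.+1) n phi) /\ comp_germ f g phi) ->
  multiplicity f = multiplicity g.
Proof.
move=> redf redg Tinv Twp [phi [Tphi fg]].
have Tstab : T (stabilization (existT (fun k => homeo_germ R k.+1) n phi)).
  by apply: Tinv; exists (existT (fun k => homeo_germ R k.+1) n phi).
have wp b : (0 < b)%N -> _ := fun b0 => Twp _ Tstab (cusp b f) (cusp b g)
  (reduced_cusp b0 redf) (reduced_cusp b0 redg) (comp_germ_cusp b fg).
have ltn_eq_false (i j : nat) : i = j -> (i < j)%N -> False by move=> ->; rewrite ltnn.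
(* The two strict cases mirror each other: weak preservation lets either cone be the linear one, so
   [phi] need not be inverted. *)
case: (ltngtP (multiplicity f) (multiplicity g)) => [lt|lt|eq_fg]; last exact: eq_fg.
- have [lin rel] := multiplicity_cusp_bound redf redg lt.
  have [] := wp _ (ltn0Sn _) (or_intror lin).
  by move=> _ _ relE; case: (ltn_eq_false _ _ relE rel).
- have [lin rel] := multiplicity_cusp_bound redg redf lt.
  have [] := wp _ (ltn0Sn _) (or_introl lin).
  by move=> _ _ relE; case: (ltn_eq_false _ _ (esym relE) rel).
Qed.
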